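(* Let $F$ be a non-archimedean local field (with finite residue field), let $\mathcal B=\mathcal B_3(F)$, and for $r\ge1$ let $S_r$ be the $r$-sphere around a fixed vertex of $\mathcal B$. Then $(S_r)_{r\ge1}$ is not a family of expanders.
   Context: Let $\mathcal O$ be the ring of integers of $F$ and $\pi$ a uniformizer. The building $\mathcal B_3(F)$ is the 2-dimensional clique complex whose vertices are homothety classes of $\mathcal O$-lattices in $F^3$, two distinct classes being adjacent iff they have representatives $L,L'$ with $\pi L<L'<L$. The $r$-sphere $S_r$ around a vertex $v_0$ is the subgraph of the one-skeleton of $\mathcal B_3(F)$ induced on the vertices at graph distance exactly $r$ from $v_0$. A sequence of finite graphs is a family of expanders if their conductances (normalized Cheeger constants) $\phi(G)=\min_{A}\frac{|E(A,V\setminus A)|}{\sum_{v\in A}\deg v}$, the minimum being over nonempty $A\subseteq V$ with $\sum_{v\in A}\deg v\le\frac12\sum_{v\in V}\deg v$, are bounded below by a positive constant; equivalently, the second largest eigenvalues of their normalized adjacency operators are bounded away from $1$. *)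

(* Defs.v *)
From HB Require Import structures.
From mathcomp Require Import all_boot all_order all_algebra.
From mathcomp Require Import finmap.
From mathcomp Require Import boolp classical_sets cardinality.
From mathcomp Require Import reals constructive_ereal.

Set Implicit Arguments.
Unset Strict Implicit.
Unset Printing Implicit Defensive.
Import Order.TTheory GRing.Theory Num.Theory.

Local Open Scope classical_set_scope.
Local Open Scope ring_scope.

(* [val_ge v n x] says that v(x) >= n, with the convention v(0) = +oo; the
   value of the function [v] at 0 is never used. *)
Definition val_ge (F : fieldType) (v : F -> int) (n : int) (x : F) : bool :=
  (x == 0) || (n <= v x).

Definition val_cauchy (F : fieldType) (v : F -> int) (u : nat -> F) :=
  forall n : int, exists N : nat, forall i j : nat,
    (N <= i)%N -> (N <= j)%N -> val_ge v n (u i - u j).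

Definition val_cvg (F : fieldType) (v : F -> int) (u : nat -> F) (l : F) :=
  forall n : int, exists N : nat, forall i : nat,
    (N <= i)%N -> val_ge v n (u i - l).

(* A structure of non-archimedean local field on F: a normalized discrete
   valuation for which F is complete and the residue field is finite.
   Finiteness of the residue field is expressed by a finite list meeting every
   class of the valuation ring modulo its maximal ideal. *)
Record local_valuation (F : fieldType) := LocalValuation {
  lval :> F -> int;
  lvalM : forall x y, x != 0 -> y != 0 -> lval (x * y) = lval x + lval y;
  lvalD : forall x y, x != 0 -> y != 0 -> x + y != 0 ->
    Num.min (lval x) (lval y) <= lval (x + y);
  lval_normalized : exists2 x, x != 0 & lval x = 1;
  lval_finite_residue : exists s : seq F, forall x, val_ge lval 0 x ->
    exists2 y, y \in s & val_ge lval 1 (x - y);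
  lval_complete : forall u, val_cauchy lval u -> exists l, val_cvg lval u l }.

Record uniformizer (F : fieldType) (v : local_valuation F) := Uniformizer {
  unif :> F;
  unif_neq0 : unif != 0;
  lval_unif : v unif = 1 }.

Definition valuation_ring (F : fieldType) (v : local_valuation F) : {pred F} :=
  val_ge v 0.

(* The O-span of a basis of F^3, the rows of M. *)
Definition is_lattice (F : fieldType) (v : local_valuation F)
    (L : set 'rV[F]_3) : Prop :=
  exists2 M : 'M[F]_3, M \in unitmx &
    L = [set u *m M | u in [set u | u \is a mxOver (valuation_ring v)]].

Definition scale_set (F : fieldType) (a : F) (L : set 'rV[F]_3) :
  set 'rV[F]_3 := [set a *: x | x in L].

Definition homothety_class (F : fieldType) (L : set 'rV[F]_3) :
  set (set 'rV[F]_3) := [set scale_set a L | a in [set a : F | a != 0]].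

Definition vertices (F : fieldType) (v : local_valuation F) :
    set (set (set 'rV[F]_3)) :=
  [set homothety_class L | L in is_lattice v].

Definition vertex (F : fieldType) (v : local_valuation F) : choiceType :=
  {C : set (set 'rV[F]_3) | C \in vertices v}.

Definition adjacent (F : fieldType) (v : local_valuation F)
    (pi : uniformizer v) : rel (vertex v) := fun C C' =>
  (C != C') &&
  `[< exists L L' : set 'rV[F]_3,
        [/\ val C L, val C' L', scale_set pi L `<` L' & L' `<` L] >].

Definition is_graph_distance (T : eqType) (e : rel T) (x y : T) (n : nat) :=
  (exists p, [/\ path e x p, last x p = y & size p = n]) /\
  (forall p, path e x p -> last x p = y -> (n <= size p)%N).

Definition sphere (T : eqType) (e : rel T) (x : T) (r : nat) : set T :=
  [set y | is_graph_distance e x y r].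

Record fgraph := FGraph {
  fvert :> finType;
  fedge : rel fvert;
  fedge_sym : symmetric fedge;
  fedge_irr : irreflexive fedge }.

Definition deg (G : fgraph) (x : G) : nat := #|[set y | fedge x y]%SET|.

Definition vol (G : fgraph) (A : {set G}) : nat := \sum_(x in A) deg x.

Definition boundary_size (G : fgraph) (A : {set G}) : nat :=
  #|[set p : G * G | [&& p.1 \in A, p.2 \notin A & fedge p.1 p.2]]%SET|.

(* The minimum is +oo when no A is admissible.  For A of volume 0 the quotient
   is 0 / 0 = 0, so a graph with an isolated vertex has conductance 0. *)
Definition conductance (R : realType) (G : fgraph) : \bar R :=
  \big[mine/+oo%E]_(A : {set G} | (A != finset.set0) &&
                                  (2 * vol A <= vol [set: G]%SET)%N)
    ((boundary_size A)%:R / (vol A)%:R)%:E.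

Definition expander_family (R : realType) (G : nat -> fgraph) : Prop :=
  exists2 c : R, 0 < c & forall n, (c%:E <= conductance R (G n))%E.

Definition induced_fgraph (T : choiceType) (e : rel T)
    (esym : symmetric e) (eirr : irreflexive e) (S : {fset T}) : fgraph :=
  @FGraph S (relpre val e) (fun x y => esym (val x) (val y))
    (fun x => eirr (val x)).

Section Building.
Variables (F : fieldType) (v : local_valuation F) (pi : uniformizer v).

Lemma scale_setM (a b : F) L : scale_set a (scale_set b L) = scale_set (a * b) L.
Proof.
apply/seteqP; split=> [_ [_ [x Lx <-] <-]|_ [x Lx <-]].
  by exists x; rewrite // scalerA.
by exists (b *: x); [exists x | rewrite scalerA].
Qed.

Lemma scale_set1 (L : set 'rV[F]_3) : scale_set 1 L = L.
Proof.
apply/seteqP; split=> [_ [x Lx <-]|x Lx]; first by rewrite scale1r.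
by exists x; rewrite ?scale1r.
Qed.

Lemma scale_setS (a : F) L L' : L `<=` L' -> scale_set a L `<=` scale_set a L'.
Proof. by move=> s _ [x Lx <-]; exists x => //; apply: s. Qed.

Lemma scale_set_proper (a : F) L L' : a != 0 ->
  L `<` L' -> scale_set a L `<` scale_set a L'.
Proof.
move=> a0 [s ns]; split; first exact: scale_setS.
move=> /(scale_setS (a := a^-1)).
by rewrite !scale_setM mulVf// !scale_set1.
Qed.

Lemma vertex_scale (C : vertex v) L (a : F) :
  a != 0 -> val C L -> val C (scale_set a L).
Proof.
move=> a0; case: C => C /= /set_mem [L0 _ <-] [b b0 <-].
by rewrite scale_setM; exists (a * b) => //=; rewrite mulf_neq0.
Qed.

Lemma adjacent_irr : irreflexive (adjacent pi).
Proof. by move=> C; rewrite /adjacent eqxx. Qed.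

Lemma adjacent_sym : symmetric (adjacent pi).
Proof.
suff h C C' : adjacent pi C C' -> adjacent pi C' C.
  by move=> C C'; apply/idP/idP; apply: h.
case/andP=> CC' /asboolP[L [L' [CL C'L' s1 s2]]].
rewrite /adjacent eq_sym CC' /=; apply/asboolP.
exists L', (scale_set pi L); split=> //.
  by apply: vertex_scale => //; apply: unif_neq0.
by apply: scale_set_proper => //; apply: unif_neq0.
Qed.

Lemma val_geD n x y : val_ge v n x -> val_ge v n y -> val_ge v n (x + y).
Proof.
rewrite /val_ge; have [->|x0] /= := eqVneq x 0; first by rewrite add0r.
have [->|y0] /= := eqVneq y 0; first by rewrite addr0 (negPf x0).
have [//|xy0] /= := eqVneq (x + y) 0 => nx ny.
by apply: le_trans (lvalD v x0 y0 xy0); rewrite le_min nx.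
Qed.

Lemma lval1 : v 1 = 0.
Proof.
by apply: (@addrI _ (v 1)); rewrite -lvalM ?oner_neq0// mulr1 addr0.
Qed.

Lemma lvalN1 : v (-1) = 0.
Proof.
have h : v (-1) + v (-1) = 0 by rewrite -lvalM ?oppr_eq0 ?oner_neq0// mulrNN mulr1 lval1.
by move/eqP: h; rewrite -mulr2n mulrn_eq0 => /orP[//|/eqP].
Qed.

Lemma val_geN n x : val_ge v n x -> val_ge v n (- x).
Proof.
rewrite /val_ge oppr_eq0; have [//|x0] /= := eqVneq x 0.
by rewrite -mulN1r lvalM ?oppr_eq0 ?oner_neq0// lvalN1 add0r.
Qed.

Lemma lattice_closed L : is_lattice v L ->
  (forall x y, L x -> L y -> L (x + y)) /\ (forall x y, L x -> L y -> L (x - y)).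
Proof.
move=> [M _ ->]; split=> _ _ [x /mxOverP xO <-] [y /mxOverP yO <-].
  exists (x + y); last by rewrite mulmxDl.
  by apply/mxOverP => i j; rewrite mxE; apply: val_geD; [apply: xO|apply: yO].
exists (x - y); last by rewrite mulmxBl.
apply/mxOverP => i j; rewrite !mxE.
by apply: val_geD; [apply: xO|apply/val_geN/yO].
Qed.

Lemma lattice_scale L (a : F) : a != 0 -> is_lattice v L -> is_lattice v (scale_set a L).
Proof.
move=> a0 [M Mu ->]; exists (a *: M).
  by rewrite unitmxZ // unitfE.
apply/seteqP; split=> [_ [_ [u uO <-] <-]|_ [u uO <-]].
  by exists u; rewrite // scalemxAr.
by exists (u *m M); [exists u | rewrite scalemxAr].
Qed.

Lemma class_scale L (a : F) : a != 0 ->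
  homothety_class (scale_set a L) = homothety_class L.
Proof.
move=> a0; apply/seteqP; split=> [_ [b b0 <-]|_ [b b0 <-]].
  by rewrite scale_setM; exists (b * a) => //=; rewrite mulf_neq0.
exists (b / a); first by rewrite /= mulf_neq0// invr_eq0.
by rewrite scale_setM divfK.
Qed.

Lemma finite_between L : is_lattice v L ->
  finite_set [set L' | [/\ is_lattice v L', scale_set pi L `<=` L' & L' `<=` L]].
Proof.
move=> [M Mu LE]; have [s sP] := lval_finite_residue v.
pose I : finType := {ffun 'I_3 -> seq_sub s}.
pose vec (t : I) : 'rV[F]_3 := (\row_j val (t j)) *m M.
pose f (X : {set I}) : set 'rV[F]_3 :=
  [set x | exists2 t, t \in X & scale_set pi L (x - vec t)].
apply: (sub_finite_set _ (finite_image f (@finite_finset {set I} setT))).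
move=> L' [/lattice_closed[cD cB] s1 s2] /=.
exists [set t | `[< L' (vec t) >]]%SET => //.
apply/seteqP; split=> [x [t]|x L'x].
  by rewrite inE => /asboolP L't /s1 h; rewrite -(subrK (vec t) x); apply: cD.
have : L x by apply: s2.
rewrite {1}LE => -[u /mxOverP uO uE].
have /choice[g gP] : forall j : 'I_3,
    exists y : seq_sub s, val_ge v 1 (u 0 j - val y).
  by move=> j; have [y ys h] := sP _ (uO 0 j); exists (SeqSub ys).
have h : scale_set pi L (x - vec (finfun g)).
  have pi0 := unif_neq0 pi.
  rewrite -uE /vec -mulmxBl; set w := u - _.
  exists ((pi : F)^-1 *: (w *m M)); last by rewrite scalerA mulfV// scale1r.
  rewrite LE; exists ((pi : F)^-1 *: w); last by rewrite scalemxAl.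
  apply/mxOverP => i j; rewrite !mxE ffunE (ord1 i); have := gP j.
  rewrite /in_mem /= /valuation_ring /val_ge; set z := u 0 j - _.
  rewrite mulf_eq0 invr_eq0 (negPf pi0) /=.
  have [//|z0] /= := eqVneq z 0.
  rewrite lvalM ?invr_eq0//.
  have : v (pi : F)^-1 + v pi = 0 by rewrite -lvalM ?invr_eq0// mulVf// lval1.
  by rewrite lval_unif => /eqP; rewrite addr_eq0 => /eqP ->; rewrite addrC subr_ge0.
exists (finfun g) => //; rewrite inE; apply/asboolP.
have -> : vec (finfun g) = x - (x - vec (finfun g)) by rewrite opprB addrC subrK.
by apply: cB => //; apply: s1.
Qed.

Lemma finite_neighbors (C : vertex v) : finite_set [set C' | adjacent pi C C'].
Proof.
have /set_mem [L Ll CE] := valP C.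
apply: (@sub_finite_set _ _ [set C' | exists2 L', [/\ is_lattice v L',
    scale_set pi L `<=` L' & L' `<=` L] & val C' = homothety_class L']).
  move=> C' /= /andP[_ /asboolP[L1 [L' [+ C'L' [s1 _] [s2 _]]]]].
  rewrite -CE => -[a a0 aE]; subst L1; exists (scale_set a^-1 L').
    split.
    - have /set_mem [L0 L0l C'E] := valP C'.
      move: C'L'; rewrite -C'E => -[b b0 <-].
      by rewrite scale_setM; apply: lattice_scale => //; rewrite mulf_neq0// invr_eq0.
    - move/(scale_setS (a := a^-1)): s1.
      by rewrite !scale_setM mulrAC mulVf// mul1r.
    - by move/(scale_setS (a := a^-1)): s2; rewrite !scale_setM mulVf// scale_set1.
  rewrite class_scale ?invr_eq0//.
  have /set_mem [L0 L0l C'E] := valP C'.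
  by move: C'L'; rewrite -C'E => -[b b0 <-]; rewrite class_scale.
have /choice[g gP] : forall L', exists D : vertex v,
    is_lattice v L' -> val D = homothety_class L'.
  move=> L'; have [L'l|nl] := pselect (is_lattice v L'); last by exists C.
  have m : homothety_class L' \in vertices v by apply/mem_set; exists L'.
  by exists (exist (fun D => D \in vertices v) _ m).
apply: sub_finite_set (finite_image g (finite_between Ll)) => C' /= [L' h E].
by exists L' => //; apply: val_inj; rewrite /= gP//; case: h.
Qed.

Lemma finite_sphere (C : vertex v) (r : nat) : finite_set (sphere (adjacent pi) C r).
Proof.
apply: (@sub_finite_set _ _ [set D | exists p,
    [/\ path (adjacent pi) C p, last C p = D & size p = r]]); first by move=> D [].
elim: r => [|r IH].
  by apply: sub_finite_set (finite_set1 C) => D [p [_ + s0]]; rewrite (size0nil s0) => <-.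
apply: sub_finite_set (bigcup_finite IH (fun D _ => finite_neighbors D)).
move=> D [p []]; case/lastP: p => // p D'.
rewrite rcons_path last_rcons size_rcons => /andP[pp e] <- [sp].
by exists (last C p) => //=; exists p.
Qed.

End Building.

(* [fset_set] would be empty on an infinite set; [finite_sphere] rules this
   out. *)
Definition sphere_graph (F : fieldType) (v : local_valuation F)
    (pi : uniformizer v) (v0 : vertex v) (r : nat) : fgraph :=
  induced_fgraph (adjacent_sym pi) (@adjacent_irr F v pi)
    (fset_set (sphere (adjacent pi) v0 r)).

(* Main.v *)
From mathcomp Require Import all_boot all_order all_algebra.
From mathcomp Require Import fingroup perm.
From mathcomp Require Import finmap.
From mathcomp Require Import boolp classical_sets cardinality.
From mathcomp Require Import reals constructive_ereal.
From mathcomp Require Import zify ring.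
Require Import Defs.

(* Fix a lattice L0 representing v0.  By the Cartan decomposition every vertex
   is represented by a unique L = <e1, pi^i e2, pi^r e3>, where e1, e2, e3 is a
   basis of L0 and 0 <= i <= r; then r is its distance to v0, and i depends only
   on the vertex.  Inside S_r every edge changes i by exactly 1, and for
   0 < i < r a vertex has as many neighbours at height i + 1 as at height i - 1:
   both kinds are parametrized by t in O / pi, through
   <e1 + t pi^i e2, pi^(i+1) e2, pi^r e3> and
   <e1, pi^(i-1) (e2 + t pi^(r-i) e3), pi^r e3>.  Hence the number of edges
   between consecutive heights is a constant, so the set of vertices of height
   at most k has volume 2k + 1 times the size of its boundary; for r = 2k + 1
   it carries at most half of the volume. *)

Set Implicit Arguments.
Unset Strict Implicit.
Unset Printing Implicit Defensive.
Import Order.TTheory GRing.Theory Num.Theory.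

Local Open Scope classical_set_scope.
Local Open Scope ring_scope.

(** * Layered graphs *)

Section LayeredGraph.
Variables (G : Defs.fgraph) (h : G -> nat) (r : nat).

Let up (x : G) := #|[set y | fedge x y && (h y == (h x).+1)]%SET|.
Let down (x : G) := #|[set y | fedge x y && ((h y).+1 == h x)]%SET|.

Hypothesis h_edge : forall x y : G, fedge x y ->
  h y = (h x).+1 \/ (h y).+1 = h x.
Hypothesis h_bound : forall x, (h x <= r)%N.
Hypothesis h_balanced : forall x, (0 < h x < r)%N -> up x = down x.

Let ups (j : nat) := (\sum_(x | h x == j) up x)%N.
Let downs (j : nat) := (\sum_(x | h x == j) down x)%N.

Lemma upE x : up x = (\sum_(y | fedge x y && (h y == (h x).+1)) 1)%N.
Proof. by rewrite sum1_card; apply: eq_card => y; rewrite inE. Qed.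

Lemma downE x : down x = (\sum_(y | fedge x y && ((h y).+1 == h x)) 1)%N.
Proof. by rewrite sum1_card; apply: eq_card => y; rewrite inE. Qed.

Lemma deg_up_down x : deg x = (up x + down x)%N.
Proof.
rewrite /deg /up /down -cardsUI.
rewrite [X in (_ + #|pred_of_set X|)%N](_ : _ = finset.set0) ?cards0 ?addn0.
  apply: eq_card => y; rewrite !inE -andb_orr.
  case e: (fedge x y) => //=; symmetry; apply/orP.
  by case: (h_edge e) => ->; rewrite eqxx; [left|right].
apply/setP => y; rewrite !inE; apply/negP => /andP[/andP[_ /eqP ->] /andP[_]].
by move=> /eqP/(congr1 (fun n => n - h x)%N); rewrite subnn -addn2 addKn.
Qed.

(** Both sides count the edges between layers [j] and [j.+1], each from one end; swapping the
    endpoints of a pair matches the two counts. *)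
Lemma downsS j : downs j.+1 = ups j.
Proof.
rewrite /downs /ups; under eq_bigr do rewrite downE.
under [RHS]eq_bigr do rewrite upE.
rewrite !pair_big_dep /= [RHS](reindex_inj (h := fun p : G * G => (p.2, p.1))) /=.
  apply: eq_bigl => -[x y] /=; rewrite fedge_sym.
  by case: (fedge y x); rewrite ?andbF //=; lia.
by move=> [a b] [c d] [-> ->].
Qed.

Lemma downs0 : downs 0 = 0%N.
Proof.
rewrite /downs big1 // => x /eqP hx.
by apply/eqP; rewrite cards_eq0; apply/eqP/setP => y; rewrite !inE hx andbF.
Qed.

(** Balance in layer [j.+1] turns [downs j.+1] into [ups j.+1], so the edge count passes from each
    gap between layers to the next one. *)
Lemma ups_const j : (j < r)%N -> ups j = ups 0.
Proof.
elim: j => // j IH jr; rewrite -(IH (ltnW jr)) -[RHS]downsS.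
by apply: eq_bigr => x /eqP hx; rewrite h_balanced // hx.
Qed.

Lemma ups_top : ups r = 0%N.
Proof.
rewrite /ups big1 // => x /eqP hx.
apply/eqP; rewrite cards_eq0; apply/eqP/setP => y; rewrite !inE hx.
apply/negP => /andP[_ /eqP hy].
by have := h_bound y; rewrite hy ltnn.
Qed.

Let sublevel k := [set x | (h x <= k)%N]%SET.

Lemma vol_sublevel k : vol (sublevel k) = (\sum_(j < k.+1) (ups j + downs j))%N.
Proof.
rewrite /vol (eq_bigl (fun x => (h x <= k)%N)); last by move=> x; rewrite inE.
elim: k => [|k IH].
  rewrite big_ord1 /ups /downs -big_split; apply: eq_big => x; first by rewrite leqn0.
  by rewrite deg_up_down.
rewrite big_ord_recr /= -IH (bigID (fun x => h x <= k)%N) /=; congr (_ + _)%N.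
  apply: eq_bigl => x; rewrite andbC; case: leqP => //= /leq_trans -> //.
rewrite /ups /downs -big_split; apply: eq_big => x; last by rewrite deg_up_down.
by rewrite -ltnNge eqn_leq.
Qed.

(** Layer 0 has no edge downwards and contributes [ups 0] once; each of the other [k] layers
    contributes it in both directions. *)
Lemma vol_sublevel_const k : (k < r)%N -> vol (sublevel k) = ((2 * k).+1 * ups 0)%N.
Proof.
rewrite vol_sublevel; elim: k => [|k IH] kr.
  by rewrite big_ord1 downs0 addn0 mul1n.
have kr' := ltnW kr; rewrite big_ord_recr IH //= downsS !ups_const //.
by move: (ups 0) => u; lia.
Qed.

(** The top layer sends no edge upwards, so layers 0 and [r] contribute [ups 0] once each, and the
    [r - 1] layers between them twice. *)
Lemma vol_total : (0 < r)%N -> vol [set: G]%SET = (2 * r * ups 0)%N.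
Proof.
move=> r0; have -> : [set: G]%SET = sublevel r.
  by apply/setP => x; rewrite !inE h_bound.
have r1 : (r.-1 < r)%N by rewrite prednK.
rewrite -{1}(prednK r0) vol_sublevel big_ord_recr -vol_sublevel /= downsS.
rewrite prednK // ups_top (ups_const r1) (vol_sublevel_const r1).
by rewrite -[in RHS](prednK r0); move: (ups 0) => u; lia.
Qed.

(** Heights change by one along an edge, so an edge leaves the sublevel set only from layer [k] to
    layer [k.+1]. *)
Lemma boundary_sublevel k : (k < r)%N -> boundary_size (sublevel k) = ups 0.
Proof.
move=> kr; rewrite -(ups_const kr) /ups.
under eq_bigr do rewrite upE.
rewrite pair_big_dep /= sum1_card; apply: eq_card => -[x y] /=; rewrite !inE /= -ltnNge.
rewrite unfold_in /=.
case e: (fedge x y); rewrite ?andbF //= andbT.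
by move: (h_edge e); move: (h x) (h y) => a b; clear; lia.
Qed.

Lemma layered_conductance (R : realType) k : ((2 * k).+1 <= r)%N ->
  (exists x, h x = 0%N) -> (conductance R G <= ((2 * k).+1%:R^-1 : R)%:E)%E.
Proof.
move=> kr [x0 hx0]; have kr' : (k < r)%N by apply: leq_trans kr; rewrite ltnS leq_pmull.
have A0 : sublevel k != finset.set0.
  by apply/set0Pn; exists x0; rewrite inE hx0.
(* With u = [ups 0] this reads 2 (2k + 1) u <= 2 r u, which follows from [kr]. *)
have Ahalf : (2 * vol (sublevel k) <= vol [set: G]%SET)%N.
  rewrite vol_sublevel_const // vol_total; last exact: leq_ltn_trans kr'.
  by rewrite mulnA leq_mul // leq_mul.
apply: (@le_trans _ _ ((boundary_size (sublevel k))%:R / (vol (sublevel k))%:R : R)%:E).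
  by apply: bigmin_le_cond; rewrite A0.
rewrite lee_fin boundary_sublevel // vol_sublevel_const //.
(* If [ups 0] vanishes, the quotient is 0 by the convention on division; otherwise [ups 0]
   cancels. *)
have [->|u0] := eqVneq (ups 0) 0%N; first by rewrite mul0r invr_ge0 ler0n.
by rewrite natrM invfM mulrCA divff ?mulr1 // pnatr_eq0.
Qed.

End LayeredGraph.

(** * Smith normal form over the valuation ring *)

Section Valuation.
Variables (F : fieldType) (v : local_valuation F).
Implicit Types (x y : F) (m n : int).

Lemma val_ge0 n : val_ge v n 0.
Proof. by rewrite /val_ge eqxx. Qed.

Lemma val_ge_le m n x : m <= n -> val_ge v n x -> val_ge v m x.
Proof. by rewrite /val_ge => mn /orP[->//|nx]; rewrite (le_trans mn nx) orbT. Qed.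

Lemma val_geB n x y : val_ge v n x -> val_ge v n y -> val_ge v n (x - y).
Proof. by move=> nx ny; apply/val_geD/val_geN. Qed.

Lemma lvalV x : x != 0 -> v x^-1 = - v x.
Proof.
move=> x0; apply/eqP; rewrite -addr_eq0 -lvalM ?invr_eq0 // mulVf //.
by rewrite lval1.
Qed.

Lemma val_geMl n x y : x != 0 -> val_ge v n (x * y) = val_ge v (n - v x) y.
Proof.
move=> x0; rewrite /val_ge mulf_eq0 (negPf x0) /=.
by have [//|y0] := eqVneq y 0; rewrite lvalM //= lerBlDl.
Qed.

Lemma val_geM m n x y : val_ge v m x -> val_ge v n y -> val_ge v (m + n) (x * y).
Proof.
have [->|x0] := eqVneq x 0; first by move=> *; rewrite mul0r val_ge0.
rewrite val_geMl // {1}/val_ge (negPf x0) /= => mx; apply: val_ge_le; lia.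
Qed.

Lemma val_geM0 n x y : val_ge v 0 x -> val_ge v n y -> val_ge v n (x * y).
Proof. by move=> hx hy; rewrite -[n]add0r val_geM. Qed.

Lemma val_ge_lval x : val_ge v (v x) x.
Proof. by rewrite /val_ge lexx orbT. Qed.

Lemma val_geE n x : x != 0 -> val_ge v n x = (n <= v x).
Proof. by rewrite /val_ge => /negPf->. Qed.

Lemma val_geNge n x : ~~ val_ge v n x -> x != 0 /\ v x < n.
Proof. by rewrite /val_ge negb_or -ltNge => /andP. Qed.

Lemma val_ge_div m n x y : val_ge v m x -> y != 0 -> v y <= m - n ->
  val_ge v n (x / y).
Proof.
move=> mx y0 vy; rewrite mulrC val_geMl ?invr_eq0 // lvalV //.
by apply: val_ge_le mx; lia.
Qed.

Lemma val_ge1 : val_ge v 0 1.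
Proof. by rewrite -(lval1 v) val_ge_lval. Qed.

Lemma lval_unifX (pi : uniformizer v) (n : nat) : v ((pi : F) ^+ n) = n.
Proof.
elim: n => [|n IH]; first by rewrite expr0 lval1.
by rewrite exprS lvalM ?expf_neq0 ?unif_neq0 // IH lval_unif; lia.
Qed.

Lemma lval_unifZ (pi : uniformizer v) n : v ((pi : F) ^ n) = n.
Proof.
case: n => n; first exact: lval_unifX.
rewrite -[LHS]/(v ((pi : F) ^+ n.+1)^-1) lvalV ?expf_neq0 ?unif_neq0 //.
by rewrite lval_unifX NegzE.
Qed.

Lemma unifZ_neq0 (pi : uniformizer v) n : (pi : F) ^ n != 0.
Proof. exact/expfz_neq0/unif_neq0. Qed.

End Valuation.

(** * Matrices over the valuation ring and their reduction to diagonal form *)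

Section IntegralMatrices.
Variables (F : fieldType) (v : local_valuation F).

Definition mx_val_ge (n : int) p q (A : 'M[F]_(p, q)) :=
  forall i j, val_ge v n (A i j).

(** Membership in GL_n(O), through an integral right inverse, which for square matrices is
    two-sided. *)
Definition integral_unit n (U : 'M[F]_n) :=
  exists V, [/\ mx_val_ge 0 U, mx_val_ge 0 V & U *m V = 1%:M].

Lemma val_ge_sum (n : int) (I : finType) (f : I -> F) :
  (forall i, val_ge v n (f i)) -> val_ge v n (\sum_i f i).
Proof.
by move=> h; elim/big_ind: _ => // [|x y]; [exact: val_ge0 | exact: val_geD].
Qed.

Lemma val_ge_prod (I : finType) (f : I -> F) :
  (forall i, val_ge v 0 (f i)) -> val_ge v 0 (\prod_i f i).
Proof.
by move=> h; elim/big_ind: _ => // [|x y]; [exact: val_ge1 | exact: val_geM0].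
Qed.

Lemma mx_val_geM m n p q s (A : 'M[F]_(p, q)) (B : 'M[F]_(q, s)) :
  mx_val_ge m A -> mx_val_ge n B -> mx_val_ge (m + n) (A *m B).
Proof. by move=> hA hB i j; rewrite mxE; apply: val_ge_sum => k; apply: val_geM. Qed.

Lemma mx_val_geM0 p q s (A : 'M[F]_(p, q)) (B : 'M[F]_(q, s)) :
  mx_val_ge 0 A -> mx_val_ge 0 B -> mx_val_ge 0 (A *m B).
Proof. by move=> hA hB; rewrite -[0]addr0; apply: mx_val_geM. Qed.

Lemma mx_val_ge0 n p q : mx_val_ge n (0 : 'M[F]_(p, q)).
Proof. by move=> i j; rewrite mxE val_ge0. Qed.

Lemma mx_val_ge1 n : mx_val_ge 0 (1%:M : 'M[F]_n).
Proof. by move=> i j; rewrite mxE; case: (_ == _); rewrite (val_ge1, val_ge0). Qed.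

Lemma mx_val_geN n p q (A : 'M[F]_(p, q)) : mx_val_ge n A -> mx_val_ge n (- A).
Proof. by move=> hA i j; rewrite mxE; apply/val_geN. Qed.

Lemma mx_val_ge_block n p1 p2 q1 q2 (A : 'M[F]_(p1, q1)) (B : 'M_(p1, q2))
    (C : 'M_(p2, q1)) (D : 'M_(p2, q2)) :
  mx_val_ge n A -> mx_val_ge n B -> mx_val_ge n C -> mx_val_ge n D ->
  mx_val_ge n (block_mx A B C D).
Proof.
move=> hA hB hC hD i j; rewrite -[i]splitK -[j]splitK.
case: (split i) => i'; case: (split j) => j' /=.
- by rewrite block_mxEul.
- by rewrite block_mxEur.
- by rewrite block_mxEdl.
- by rewrite block_mxEdr.
Qed.

Lemma integral_unitM n (U V : 'M[F]_n) :
  integral_unit U -> integral_unit V -> integral_unit (U *m V).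
Proof.
move=> [U' [iU iU' UU']] [V' [iV iV' VV']]; exists (V' *m U'); split.
- exact: mx_val_geM0.
- exact: mx_val_geM0.
- by rewrite mulmxA -(mulmxA U) VV' mulmx1.
Qed.

Lemma integral_unit1 n : integral_unit (1%:M : 'M[F]_n).
Proof. by exists 1%:M; split; rewrite ?mulmx1 //; apply: mx_val_ge1. Qed.

Lemma integral_unit_perm n (s : 'S_n) : integral_unit (perm_mx s : 'M[F]_n).
Proof.
have ip (t : 'S_n) : mx_val_ge 0 (perm_mx t : 'M[F]_n).
  by move=> i j; rewrite !mxE; case: (_ == _); rewrite (val_ge1, val_ge0).
by exists (perm_mx s^-1%g); rewrite -perm_mxM mulgV perm_mx1.
Qed.

Lemma integral_unit_lift n (U : 'M[F]_n) :
  integral_unit U -> integral_unit (block_mx 1%:M 0 0 U : 'M_(1 + n)).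
Proof.
move=> [V [iU iV UV]]; exists (block_mx 1%:M 0 0 V); split.
- by apply: mx_val_ge_block => //; [apply: mx_val_ge1|apply: mx_val_ge0..].
- by apply: mx_val_ge_block => //; [apply: mx_val_ge1|apply: mx_val_ge0..].
- by rewrite mulmx_block !mulmx0 !mul0mx !mulmx1 !addr0 !add0r UV -scalar_mx_block.
Qed.

Lemma integral_unit_lower m n (C : 'M[F]_(n, m)) :
  mx_val_ge 0 C -> integral_unit (block_mx 1%:M 0 C 1%:M).
Proof.
move=> iC; exists (block_mx 1%:M 0 (- C) 1%:M); split.
- by apply: mx_val_ge_block => //; (apply: mx_val_ge1 || apply: mx_val_ge0).
- apply: mx_val_ge_block; try (apply: mx_val_ge1 || apply: mx_val_ge0).
  exact: mx_val_geN.
- rewrite mulmx_block !mulmx0 !mul0mx !mulmx1 !mul1mx !addr0 !add0r subrr.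
  by rewrite -scalar_mx_block.
Qed.

Lemma integral_unit_upper m n (C : 'M[F]_(m, n)) :
  mx_val_ge 0 C -> integral_unit (block_mx 1%:M C 0 1%:M).
Proof.
move=> iC; exists (block_mx 1%:M (- C) 0 1%:M); split.
- by apply: mx_val_ge_block => //; (apply: mx_val_ge1 || apply: mx_val_ge0).
- apply: mx_val_ge_block; try (apply: mx_val_ge1 || apply: mx_val_ge0).
  exact: mx_val_geN.
- rewrite mulmx_block !mulmx0 !mul0mx !mulmx1 !mul1mx !addr0 !add0r addNr.
  by rewrite -scalar_mx_block.
Qed.

Lemma integral_unit_unitmx n (U : 'M[F]_n) : integral_unit U -> U \in unitmx.
Proof. by move=> [V [_ _ /mulmx1_unit[]]]. Qed.

Lemma integral_unit_inv n (U : 'M[F]_n) : integral_unit U -> integral_unit (invmx U).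
Proof.
move=> iU; have Uu := integral_unit_unitmx iU; case: iU => V [iU iV UV].
have -> : invmx U = V by rewrite -[LHS]mulmx1 -UV mulmxA mulVmx // mul1mx.
by exists U; split=> //; apply: mulmx1C.
Qed.

(** The minimum runs over the nonzero entries only, since the value of [v] at 0 is meaningless; zero
    entries satisfy [val_ge] in any case. *)
Lemma exists_min_lval p q (A : 'M[F]_(p, q)) : A != 0 ->
  exists i j, A i j != 0 /\ mx_val_ge (v (A i j)) A.
Proof.
move=> A0; have [k Pk] : exists k : 'I_p * 'I_q, A k.1 k.2 != 0.
  apply: contrapT => h; move/eqP: A0; apply; apply/matrixP => i j; rewrite mxE.
  by apply/eqP/negPn/negP => Aij; apply: h; exists (i, j).
case: (@Order.TotalTheory.arg_minP _ _ _ k (fun k => A k.1 k.2 != 0) (fun k => v (A k.1 k.2)) Pk).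
move=> [i j] /= Aij mn; exists i, j; split=> // i' j'.
have [->|A'] := eqVneq (A i' j') 0; first exact: val_ge0.
by rewrite val_geE //; apply: (mn (i', j')).
Qed.

(** Induction on the size: an entry of least valuation is moved to the corner, its row and column
    are cleared, and the remaining block is diagonalized. Minimality makes the multipliers used for
    clearing integral. *)
Lemma smith_normal_form n (A : 'M[F]_n) : A \in unitmx ->
  exists U P d, [/\ integral_unit U, integral_unit P, U *m A *m P = diag_mx d &
    forall i j : 'I_n, (i <= j)%N -> val_ge v (v (d 0 i)) (d 0 j)].
Proof.
elim: n A => [|n IH] A uA.
  exists 1%:M, 1%:M, 0; split; try exact: integral_unit1; last by case.
  by apply/matrixP => -[].
have A0 : A != 0.
  by apply: contraTneq uA => ->; rewrite unitmxE det0 unitr0.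
have [i [j [Aij minA]]] := exists_min_lval A0.
(* A row transposition and a column transposition bring the entry of least valuation to the
   corner. *)
wlog [i0 j0] : A i j uA A0 Aij minA / i = 0 /\ j = 0.
  move=> H; pose A' := xrow i 0 (xcol j 0 A).
  have A'E : A' = tperm_mx i 0 *m A *m tperm_mx j 0 by rewrite /A' xrowE xcolE mulmxA.
  have uA' : A' \in unitmx by rewrite A'E !unitmx_mul uA !unitmx_perm.
  have A'00 : A' 0 0 = A i j by rewrite !mxE !tpermR.
  have [||| //|U [P [d [iU iP E sd]]]] := H A' 0 0 uA'.
  - by apply: contraTneq uA' => ->; rewrite unitmxE det0 unitr0.
  - by rewrite A'00.
  - by rewrite A'00 => k l; rewrite !mxE.
  exists (U *m tperm_mx i 0), (tperm_mx j 0 *m P), d; split=> //.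
  - exact/integral_unitM/integral_unit_perm.
  - exact/integral_unitM/iP/integral_unit_perm.
  - by rewrite -E A'E !mulmxA.
subst i j; move: Aij minA; set a := A 0 0 => a0 minA.
change 'M[F]_(1 + n) in (type of A).
pose c := dlsubmx A; pose b := ursubmx A; pose D := drsubmx A.
have ulA : ulsubmx A = a%:M.
  by rewrite [LHS]mx11_scalar /a !mxE !lshift0.
have AE : A = block_mx a%:M b c D by rewrite -ulA submxK.
have div_int p q (X : 'M[F]_(p, q)) : mx_val_ge (v a) X -> mx_val_ge 0 (a^-1 *: X).
  by move=> hX k l; rewrite mxE val_geMl ?invr_eq0 // lvalV // sub0r opprK.
have iU1 : integral_unit (block_mx 1%:M 0 (- (a^-1 *: c)) 1%:M : 'M[F]_(1 + n)).
  by apply/integral_unit_lower/mx_val_geN/div_int => k l; rewrite !mxE.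
have iP1 : integral_unit (block_mx 1%:M (- (a^-1 *: b)) 0 1%:M : 'M[F]_(1 + n)).
  by apply/integral_unit_upper/mx_val_geN/div_int => k l; rewrite !mxE.
set U1 := block_mx _ _ _ _ in iU1; set P1 := block_mx _ _ _ _ in iP1.
(* The Schur complement of the pivot [a], on which the induction hypothesis is used. *)
pose D' := D - a^-1 *: (c *m b).
have elim : U1 *m A *m P1 = block_mx a%:M 0 0 D'.
  rewrite AE !mulmx_block !mulmx0 !mul0mx !mul1mx !mulmx1 ?addr0 ?add0r.
  rewrite !mulNmx !mulmxN -!scalemxAl -!scalemxAr !mul_scalar_mx !mul_mx_scalar.
  rewrite !scalerA mulVf // !scale1r !addNr mul0mx scaler0 oppr0 add0r.
  by rewrite addrC.
have uD' : D' \in unitmx.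
  have : U1 *m A *m P1 \in unitmx.
    by rewrite !unitmx_mul uA !integral_unit_unitmx.
  rewrite elim !unitmxE (det_ublock a%:M 0 D') unitrM => /andP[] //.
have [U [P [d [iU iP E sd]]]] := IH _ uD'.
exists (block_mx 1%:M 0 0 U *m U1), (P1 *m block_mx 1%:M 0 0 P), (row_mx a%:M d).
have E' : block_mx 1%:M 0 0 U *m U1 *m A *m (P1 *m block_mx 1%:M 0 0 P) =
    diag_mx (row_mx a%:M d).
  transitivity (block_mx 1%:M 0 0 U *m (U1 *m A *m P1) *m block_mx 1%:M 0 0 P).
    by rewrite !mulmxA.
  rewrite elim !mulmx_block !mulmx0 !mul0mx !mul1mx !mulmx1 !addr0 !add0r E !mul0mx diag_mx_row.
  by congr block_mx; apply/matrixP => k l; rewrite !mxE !ord1 ?eqxx /= ?mulr1n.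
have iU' : integral_unit (block_mx 1%:M 0 0 U *m U1).
  exact/integral_unitM/iU1/integral_unit_lift.
have iP' : integral_unit (P1 *m block_mx 1%:M 0 0 P).
  exact/integral_unitM/integral_unit_lift.
split=> //.
(* Multiplying [A] by integral matrices keeps all entries of valuation at least [v a], so the pivot
   divides every diagonal entry. *)
have ge_a j : val_ge v (v a) (row_mx a%:M d 0 j).
  have : mx_val_ge (v a) (diag_mx (row_mx a%:M d)).
    rewrite -E'; have [[? [? _ _]] [? [? _ _]]] := (iU', iP').
    rewrite -[v a]addr0; apply: mx_val_geM => //.
    by rewrite -[v a]add0r; apply: mx_val_geM.
  by move/(_ j j); rewrite mxE eqxx.
suff sd' (i j : 'I_(1 + n)) : (i <= j)%N ->
    val_ge v (v (row_mx a%:M d 0 i)) (row_mx a%:M d 0 j) by [].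
case: (split_ordP i) => i' ->.
  by rewrite row_mxEl (ord1 i') mxE eqxx => _; apply: ge_a.
case: (split_ordP j) => j' -> //=; first by rewrite (ord1 j') leqn0.
by rewrite !row_mxEr leq_add2l => /sd.
Qed.

End IntegralMatrices.

(** * Lattices in coordinates *)

Section Boxes.
Variables (F : fieldType) (v : local_valuation F).
Implicit Types (B M : 'M[F]_3) (x y z k s : F) (a b c : int) (L : set 'rV[F]_3).

Definition row3 x y z : 'rV[F]_3 := \row_(j < 3) [:: x; y; z]`_j.

Definition pt B x y z : 'rV[F]_3 := row3 x y z *m B.

(* The lattice spanned by pi^a b1, pi^b b2, pi^c b3, where b1, b2, b3 are the
   rows of [B]. *)
Definition box a b c B : set 'rV[F]_3 :=
  [set w | exists x y z,
    [/\ val_ge v a x, val_ge v b y, val_ge v c z & w = pt B x y z]].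

Lemma row3P (w : 'rV[F]_3) : exists x y z, w = row3 x y z.
Proof.
exists (w 0 (inord 0)), (w 0 (inord 1)), (w 0 (inord 2)); apply/rowP => j.
by rewrite mxE; case: j => -[|[|[|//]]] jlt /=; congr (w 0 _); apply: val_inj; rewrite /= inordK.
Qed.

Lemma row3_inj x y z x' y' z' :
  row3 x y z = row3 x' y' z' -> [/\ x = x', y = y' & z = z'].
Proof.
move=> /rowP e; split.
- by have := e (inord 0); rewrite !mxE !inordK.
- by have := e (inord 1); rewrite !mxE !inordK.
- by have := e (inord 2); rewrite !mxE !inordK.
Qed.

Lemma ptP B w : B \in unitmx -> exists x y z, w = pt B x y z.
Proof.
move=> uB; have [x [y [z E]]] := row3P (w *m invmx B).
by exists x, y, z; rewrite /pt -E mulmxKV.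
Qed.

Lemma pt_inj B x y z x' y' z' : B \in unitmx ->
  pt B x y z = pt B x' y' z' -> [/\ x = x', y = y' & z = z'].
Proof.
move=> uB /(congr1 (mulmx^~ (invmx B))); rewrite /pt !mulmxK //.
exact: row3_inj.
Qed.

Lemma scale_pt B k x y z : k *: pt B x y z = pt B (k * x) (k * y) (k * z).
Proof.
rewrite /pt scalemxAl; congr (_ *m _); apply/rowP => j; rewrite !mxE.
by case: j => -[|[|[|//]]].
Qed.

Lemma sub_pt B x y z x' y' z' :
  pt B x y z - pt B x' y' z' = pt B (x - x') (y - y') (z - z').
Proof.
rewrite /pt -mulmxBl; congr (_ *m _); apply/rowP => j; rewrite !mxE.
by case: j => -[|[|[|//]]].
Qed.

Lemma add_pt B x y z x' y' z' :
  pt B x y z + pt B x' y' z' = pt B (x + x') (y + y') (z + z').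
Proof.
rewrite /pt -mulmxDl; congr (_ *m _); apply/rowP => j; rewrite !mxE.
by case: j => -[|[|[|//]]].
Qed.

Lemma box_pt a b c B x y z : B \in unitmx ->
  box a b c B (pt B x y z) <-> [/\ val_ge v a x, val_ge v b y & val_ge v c z].
Proof.
move=> uB; split=> [[x' [y' [z' [hx hy hz /pt_inj]]]]|[hx hy hz]].
  by case/(_ uB) => -> -> ->.
by exists x, y, z.
Qed.

Lemma box_sub a b c a' b' c' B : a' <= a -> b' <= b -> c' <= c ->
  box a b c B `<=` box a' b' c' B.
Proof.
move=> ha hb hc _ [x [y [z [hx hy hz ->]]]]; exists x, y, z.
by split; [apply: val_ge_le hx|apply: val_ge_le hy|apply: val_ge_le hz|].
Qed.

Lemma scale_box k a b c B : k != 0 ->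
  scale_set k (box a b c B) = box (v k + a) (v k + b) (v k + c) B.
Proof.
have vk n x : k != 0 -> val_ge v n x -> val_ge v (v k + n) (k * x).
  by move=> k0 hx; apply: val_geM => //; apply: val_ge_lval.
move=> k0; apply/seteqP; split=> [_ [_ [x [y [z [hx hy hz ->]]]] <-]|].
  by exists (k * x), (k * y), (k * z); rewrite scale_pt; split; auto.
move=> _ [x [y [z [hx hy hz ->]]]].
have kK t : k * (k^-1 * t) = t by rewrite mulrA mulfV // mul1r.
have vk' n t : val_ge v (v k + n) t -> val_ge v n (k^-1 * t).
  move=> ht; rewrite val_geMl ?invr_eq0 // lvalV // opprK addrC //.
exists (pt B (k^-1 * x) (k^-1 * y) (k^-1 * z)); last by rewrite scale_pt !kK.
by exists (k^-1 * x), (k^-1 * y), (k^-1 * z); split; auto.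
Qed.

Variable pi : uniformizer v.

Lemma pt_unif_box a b c B : box a b c B (pt B ((pi : F) ^ a) ((pi : F) ^ b) ((pi : F) ^ c)).
Proof.
exists ((pi : F) ^ a), ((pi : F) ^ b), ((pi : F) ^ c).
by split=> //; rewrite val_geE ?unifZ_neq0 // lval_unifZ.
Qed.

(** The corner with coordinates pi^a, pi^b, pi^c lies in the smaller box; its coordinates in the
    common basis show the three inequalities. *)
Lemma box_subE a b c a' b' c' B : B \in unitmx ->
  box a b c B `<=` box a' b' c' B -> [/\ a' <= a, b' <= b & c' <= c].
Proof.
move=> uB /(_ _ (pt_unif_box a b c B)) /(box_pt _ _ _ _ _ _ uB).
by rewrite !val_geE ?unifZ_neq0 // !lval_unifZ.
Qed.

(** Spelled as the set in [is_lattice], so that the two are convertible. *)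
Definition lat M := [set u *m M | u in [set u : 'rV[F]_3 | u \is a mxOver (valuation_ring v)]].

Lemma latP M w : lat M w <-> exists2 u : 'rV[F]_3, mx_val_ge v 0 u & w = u *m M.
Proof.
split=> [[u /mxOverP iu <-]|[u iu ->]]; first by exists u.
by exists u => //; apply/mxOverP.
Qed.

Lemma lat_mull U M : integral_unit v U -> lat (U *m M) = lat M.
Proof.
move=> [V [iU iV UV]]; apply/seteqP; split=> w /latP[u iu ->]; apply/latP.
  by exists (u *m U); rewrite ?mulmxA //; apply: mx_val_geM0.
exists (u *m V); first exact: mx_val_geM0.
by rewrite !mulmxA -(mulmxA u) (mulmx1C UV) mulmx1.
Qed.

Lemma lat_diag (d : 'rV[F]_3) B : (forall j, d 0 j != 0) ->
  lat (diag_mx d *m B) =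
  box (v (d 0 (inord 0))) (v (d 0 (inord 1))) (v (d 0 (inord 2))) B.
Proof.
move=> d0; apply/seteqP; split=> w.
  move=> /latP[u iu ->]; have [x [y [z E]]] := row3P (u *m diag_mx d).
  have Ej j : row3 x y z 0 j = u 0 j * d 0 j by rewrite -E mul_mx_diag mxE.
  have h j : val_ge v (v (d 0 j)) (row3 x y z 0 j).
    by rewrite Ej; apply: val_geM0 => //; apply: val_ge_lval.
  exists x, y, z; rewrite mulmxA E.
  have := (h (inord 0), h (inord 1), h (inord 2)); rewrite 3!(mxE _ _ 0) !inordK //=.
  by case=> -[].
move=> [x [y [z [hx hy hz ->]]]]; apply/latP.
exists (\row_j (row3 x y z 0 j / d 0 j)).
  move=> i j; rewrite mxE; apply: val_ge_div (d0 j) _; last by rewrite subr0.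
  rewrite mxE; suff -> : d 0 j = d 0 (inord j) by
    case: j => -[|[|[|//]]] /= _.
  by rewrite inord_val.
rewrite mulmxA mul_mx_diag; congr (_ *m _); apply/rowP => j.
by rewrite mxE [in RHS]mxE divfK.
Qed.

Lemma box_lat a b c B : box a b c B =
  lat (diag_mx (row3 ((pi : F) ^ a) ((pi : F) ^ b) ((pi : F) ^ c)) *m B).
Proof.
rewrite lat_diag; last first.
  by move=> -[[|[|[|//]]] jlt]; rewrite mxE unifZ_neq0.
by rewrite !mxE !inordK //= !lval_unifZ.
Qed.

Lemma lval_prod (I : finType) (f : I -> F) : (forall i, f i != 0) ->
  v (\prod_i f i) = \sum_i v (f i).
Proof.
move=> f0; suff [] : (\prod_i f i != 0) /\ v (\prod_i f i) = \sum_i v (f i) by [].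
elim/big_rec2: _ => [|i y1 y2 _ [n0 E]]; first by rewrite oner_neq0 lval1.
by rewrite mulf_neq0 // lvalM // E.
Qed.

Lemma box_is_lattice a b c B : B \in unitmx -> is_lattice v (box a b c B).
Proof.
move=> uB; rewrite box_lat; eexists; last by [].
rewrite unitmx_mul uB andbT unitmxE det_diag unitfE prodf_seq_neq0.
by apply/allP => -[[|[|[|//]]] jlt] _ /=; rewrite mxE unifZ_neq0.
Qed.

Lemma val_ge_det n (A : 'M[F]_n) : mx_val_ge v 0 A -> val_ge v 0 (\det A).
Proof.
move=> iA; apply: val_ge_sum => s; apply: val_geM0; last exact: val_ge_prod.
by rewrite -signr_odd; case: odd; [apply: val_geN|]; exact: val_ge1.
Qed.

(** The inclusion makes M M'^-1 integral, hence its determinant has nonnegative valuation. *)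
Lemma lat_sub_det M M' : M \in unitmx -> M' \in unitmx ->
  lat M `<=` lat M' -> v (\det M') <= v (\det M).
Proof.
move=> uM uM' s; have uM'i : invmx M' \in unitmx by rewrite unitmx_inv.
have iN : mx_val_ge v 0 (M *m invmx M').
  move=> i j; have : lat M (row i M).
    apply/latP; exists (row i 1%:M); last by rewrite -row_mul mul1mx.
    by move=> k l; rewrite mxE; apply: mx_val_ge1.
  move=> /s/latP[u iu E]; have := iu 0 j; rewrite -(mulmxK uM' u) -E -row_mul mxE //.
have d0 (A : 'M[F]_3) : A \in unitmx -> \det A != 0 by rewrite unitmxE unitfE.
have := val_ge_det iN; rewrite det_mulmx det_inv val_geE.
  by rewrite lvalM ?lvalV ?invr_eq0 ?d0 // subr_ge0.
by rewrite mulf_neq0 ?invr_eq0 ?d0.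
Qed.

(** Both sides are the valuation of the determinant of a basis of the same lattice. This invariant
    later recovers the middle exponent of a vertex. *)
Lemma box_eq_det a b c B a' b' c' B' : B \in unitmx -> B' \in unitmx ->
  box a b c B = box a' b' c' B' ->
  a + b + c + v (\det B) = a' + b' + c' + v (\det B').
Proof.
move=> uB uB'; rewrite !box_lat => E.
have d0 (A : 'M[F]_3) : A \in unitmx -> \det A != 0 by rewrite unitmxE unitfE.
have p0 a1 b1 c1 j : row3 ((pi : F) ^ a1) ((pi : F) ^ b1) ((pi : F) ^ c1) 0 j != 0.
  by case: j => -[|[|[|//]]] jlt; rewrite mxE unifZ_neq0.
have det_box a1 b1 c1 B1 : B1 \in unitmx -> let M :=
    diag_mx (row3 ((pi : F) ^ a1) ((pi : F) ^ b1) ((pi : F) ^ c1)) *m B1 in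
    M \in unitmx /\ v (\det M) = a1 + b1 + c1 + v (\det B1).
  move=> uB1 M; have p0' : \prod_i row3 ((pi : F) ^ a1) ((pi : F) ^ b1) ((pi : F) ^ c1) 0 i != 0.
    by rewrite prodf_seq_neq0; apply/allP => j _; rewrite p0.
  split; first by rewrite unitmx_mul uB1 andbT unitmxE det_diag unitfE.
  rewrite det_mulmx det_diag lvalM ?d0 // lval_prod // !big_ord_recl big_ord0.
  by rewrite !mxE /= !lval_unifZ addr0 !addrA.
have [u1 <-] := det_box a b c B uB; have [u2 <-] := det_box a' b' c' B' uB'.
by apply: le_anti; rewrite !lat_sub_det // E.
Qed.

(** This is the Smith normal form U (M M0^-1) P = d of the transition matrix between bases of the
    two lattices. *)
Lemma cartan_decomposition L0 L : is_lattice v L0 -> is_lattice v L ->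
  exists B a b c, [/\ B \in unitmx, a <= b, b <= c,
    L0 = box 0 0 0 B & L = box a b c B].
Proof.
move=> [M0 uM0 ->] [M uM ->].
have uA : M *m invmx M0 \in unitmx by rewrite unitmx_mul uM unitmx_inv.
have [U [P [d [iU iP E sd]]]] := smith_normal_form v uA.
have uU := integral_unit_unitmx iU; have uP := integral_unit_unitmx iP.
(* The common basis is P^-1 M0: it spans [L0] because P is in GL_3(O), and M = U^-1 d (P^-1 M0)
   spans the same lattice as d (P^-1 M0). *)
have uB : invmx P *m M0 \in unitmx by rewrite unitmx_mul unitmx_inv uP.
have d0 j : d 0 j != 0.
  have : \det (diag_mx d) != 0.
    by rewrite -E -unitfE -unitmxE !unitmx_mul uU uP unitmx_inv uM uM0.
  rewrite det_diag prodf_seq_neq0 => /allP/(_ j); apply.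
  by rewrite mem_index_enum.
have ME : M = invmx U *m (diag_mx d *m (invmx P *m M0)).
  by rewrite -E !mulmxA mulVmx // mul1mx mulmxK // mulmxKV.
exists (invmx P *m M0), (v (d 0 (inord 0))), (v (d 0 (inord 1))), (v (d 0 (inord 2))).
split=> //.
- by have := sd (inord 0) (inord 1); rewrite !inordK // val_geE //; apply.
- by have := sd (inord 1) (inord 2); rewrite !inordK // val_geE //; apply.
- change (lat M0 = box 0 0 0 (invmx P *m M0)).
  rewrite -(lat_mull M0 (integral_unit_inv iP)) box_lat !expr0z.
  rewrite (_ : row3 1 1 1 = const_mx 1) ?diag_const_mx ?mul1mx //.
  by apply/rowP => -[[|[|[|//]]] jlt]; rewrite !mxE.
- change (lat M = box (v (d 0 (inord 0))) (v (d 0 (inord 1))) (v (d 0 (inord 2))) (invmx P *m M0)).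
  by rewrite {1}ME lat_mull ?lat_diag //; apply: integral_unit_inv.
Qed.

Lemma lattice_integral_scale L k w : is_lattice v L -> val_ge v 0 k ->
  L w -> L (k *: w).
Proof.
move=> [M _ ->] hk /latP[u iu ->]; apply/latP; exists (k *: u); last by rewrite scalemxAl.
by move=> i j; rewrite mxE; apply: val_geM0.
Qed.

(** * Elementary changes of basis and their effect on boxes *)

Definition shear01 s B := (1%:M + s *: delta_mx (inord 0) (inord 1)) *m B.
Definition shear12 s B := (1%:M + s *: delta_mx (inord 1) (inord 2)) *m B.
Definition swap01 B := tperm_mx (inord 0) (inord 1) *m B.

Lemma pt_shear01 s B x y z : pt (shear01 s B) x y z = pt B x (y + s * x) z.
Proof.
rewrite /pt /shear01 mulmxA mulmxDr mulmx1 -scalemxAr; congr (_ *m _).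
apply/rowP => j; rewrite !mxE !big_ord_recl big_ord0 !mxE /=.
case: j => -[|[|[|//]]] jlt; rewrite /= -!val_eqE /= ?inordK //= /bump /=;
  rewrite ?(mulr0, mulr1, addr0, add0r) //.
Qed.

Lemma pt_shear12 s B x y z : pt (shear12 s B) x y z = pt B x y (z + s * y).
Proof.
rewrite /pt /shear12 mulmxA mulmxDr mulmx1 -scalemxAr; congr (_ *m _).
apply/rowP => j; rewrite !mxE !big_ord_recl big_ord0 !mxE /=.
case: j => -[|[|[|//]]] jlt; rewrite /= -!val_eqE /= ?inordK //= /bump /=;
  rewrite ?(mulr0, mulr1, addr0, add0r) //.
Qed.

Lemma pt_swap01 B x y z : pt (swap01 B) x y z = pt B y x z.
Proof.
rewrite /pt /swap01 mulmxA -xcolE; congr (_ *m _); apply/rowP => j; rewrite !mxE.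
have [->|[->|->]] : j = inord 0 \/ j = inord 1 \/ j = inord 2.
- by case: j => -[|[|[|//]]] jlt; [left|right; left|right; right]; apply: val_inj; rewrite /= inordK.
- by rewrite tpermL !inordK.
- by rewrite tpermR !inordK.
- by rewrite tpermD ?inordK // -val_eqE /= !inordK.
Qed.

Lemma transvection_unit n (i j : 'I_n) s : i != j ->
  1%:M + s *: delta_mx i j \in @unitmx F n.
Proof.
move=> ij; suff /mulmx1_unit[] :
    (1%:M + s *: delta_mx i j) *m (1%:M - s *: delta_mx i j) = 1%:M :> 'M[F]_n by [].
rewrite mulmxDl mul1mx mulmxBr mulmx1 -scalemxAl -scalemxAr mul_delta_mx_0 1?eq_sym //.
by rewrite !scaler0 subr0 subrK.
Qed.

Lemma shear01_unit s B : B \in unitmx -> shear01 s B \in unitmx.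
Proof.
by move=> uB; rewrite unitmx_mul uB transvection_unit // -val_eqE /= !inordK.
Qed.

Lemma shear12_unit s B : B \in unitmx -> shear12 s B \in unitmx.
Proof.
by move=> uB; rewrite unitmx_mul uB transvection_unit // -val_eqE /= !inordK.
Qed.

Lemma swap01_unit B : B \in unitmx -> swap01 B \in unitmx.
Proof. by move=> uB; rewrite unitmx_mul unitmx_perm uB. Qed.

(** The shear replaces b1 by b1 + s b2, and the condition on s puts pi^a s b2 in the O-span of pi^b
    b2. *)
Lemma box_shear01 a b c s B : val_ge v (b - a) s ->
  box a b c (shear01 s B) = box a b c B.
Proof.
move=> hs; have hsx x : val_ge v a x -> val_ge v b (s * x).
  by move=> hx; rewrite -(subrK a b); apply: val_geM.
apply/seteqP; split=> w [x [y [z [hx hy hz ->]]]].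
  by exists x, (y + s * x), z; rewrite pt_shear01; split=> //; apply: val_geD; auto.
exists x, (y - s * x), z; rewrite pt_shear01 subrK; split=> //.
by apply: val_geB; auto.
Qed.

Lemma box_shear12 a b c s B : val_ge v (c - b) s ->
  box a b c (shear12 s B) = box a b c B.
Proof.
move=> hs; have hsx x : val_ge v b x -> val_ge v c (s * x).
  by move=> hx; rewrite -(subrK b c); apply: val_geM.
apply/seteqP; split=> w [x [y [z [hx hy hz ->]]]].
  by exists x, y, (z + s * y); rewrite pt_shear12; split=> //; apply: val_geD; auto.
exists x, y, (z - s * y); rewrite pt_shear12 subrK; split=> //.
by apply: val_geB; auto.
Qed.

Lemma shear01_shear01 s s' B : shear01 s (shear01 s' B) = shear01 (s + s') B.
Proof.
rewrite /shear01 mulmxA; congr (_ *m _).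
rewrite mulmxDl mul1mx mulmxDr mulmx1 -scalemxAl -scalemxAr mul_delta_mx_0.
  by rewrite !scaler0 addr0 scalerDl addrAC addrA.
by rewrite -val_eqE /= !inordK.
Qed.

Lemma shear12_shear12 s s' B : shear12 s (shear12 s' B) = shear12 (s + s') B.
Proof.
rewrite /shear12 mulmxA; congr (_ *m _).
rewrite mulmxDl mul1mx mulmxDr mulmx1 -scalemxAl -scalemxAr mul_delta_mx_0.
  by rewrite !scaler0 addr0 scalerDl addrAC addrA.
by rewrite -val_eqE /= !inordK.
Qed.

(** Shears compose additively, so only s - s' matters; for the necessity of the condition, the
    vector pi^a times the first row of the sheared basis is tested. *)
Lemma box_shear01_eq a b c s s' B : B \in unitmx ->
  box a b c (shear01 s B) = box a b c (shear01 s' B) <-> val_ge v (b - a) (s - s').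
Proof.
move=> uB; rewrite -{1}(subrK s' s) -shear01_shear01; split=> [E|]; last exact: box_shear01.
have : box a b c (shear01 s' B) (pt (shear01 (s - s') (shear01 s' B)) ((pi : F) ^ a) 0 0).
  rewrite -E; exists ((pi : F) ^ a), 0, 0; rewrite !val_ge0; split=> //.
  by rewrite val_geE ?unifZ_neq0 // lval_unifZ.
rewrite pt_shear01 add0r => /(box_pt _ _ _ _ _ _ (shear01_unit s' uB))[_ + _].
by rewrite mulrC val_geMl ?unifZ_neq0 // lval_unifZ.
Qed.

Lemma box_shear12_eq a b c s s' B : B \in unitmx ->
  box a b c (shear12 s B) = box a b c (shear12 s' B) <-> val_ge v (c - b) (s - s').
Proof.
move=> uB; rewrite -{1}(subrK s' s) -shear12_shear12; split=> [E|]; last exact: box_shear12.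
have : box a b c (shear12 s' B) (pt (shear12 (s - s') (shear12 s' B)) 0 ((pi : F) ^ b) 0).
  rewrite -E; exists 0, ((pi : F) ^ b), 0; rewrite !val_ge0; split=> //.
  by rewrite val_geE ?unifZ_neq0 // lval_unifZ.
rewrite pt_shear12 add0r => /(box_pt _ _ _ _ _ _ (shear12_unit s' uB))[_ _].
by rewrite mulrC val_geMl ?unifZ_neq0 // lval_unifZ.
Qed.

Lemma box_swap01 a b c B : box a b c (swap01 B) = box b a c B.
Proof.
by apply/seteqP; split=> w [x [y [z [hx hy hz ->]]]]; exists y, x, z;
  rewrite pt_swap01.
Qed.

End Boxes.

(** * Distance in the building *)

Section Vertices.
Variables (F : fieldType) (v : local_valuation F) (pi : uniformizer v).
Implicit Types (C : vertex v) (L : set 'rV[F]_3).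

Lemma val_class C L : val C L -> val C = homothety_class L.
Proof.
have /set_mem [L1 _ <-] := valP C.
by move=> [k k0 <-]; rewrite class_scale.
Qed.

Lemma val_lattice C L : val C L -> is_lattice v L.
Proof.
have /set_mem [L1 lL1 <-] := valP C.
by move=> [k k0 <-]; apply: lattice_scale.
Qed.

Lemma val_inj_lattice C C' L : val C L -> val C' L -> C = C'.
Proof. by move=> h h'; apply: val_inj; rewrite (val_class h) (val_class h'). Qed.

Lemma val_scale C L L' : val C L -> val C L' -> exists2 k, k != 0 & L' = scale_set k L.
Proof. by move=> /val_class-> [k k0 <-]; exists k. Qed.

Lemma exists_vertex L : is_lattice v L -> exists C, val C L.
Proof.
move=> lL; have m : homothety_class L \in vertices v by apply/mem_set; exists L.
exists (exist (fun D => D \in vertices v) _ m) => /=.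
by exists 1; [exact: oner_neq0 | exact: scale_set1].
Qed.

(** Adjacency provides some pair of representatives; rescaling both makes the first one the given
    [L]. *)
Lemma adjacent_rep C C' L : adjacent pi C C' -> val C L ->
  exists L', [/\ val C' L', scale_set pi L `<` L' & L' `<` L].
Proof.
move=> /andP[_ /asboolP[A [A' [CA C'A' s1 s2]]]] CL.
have [k k0 ->] := val_scale CA CL; exists (scale_set k A'); split.
- exact: vertex_scale.
- by rewrite scale_setM mulrC -scale_setM; apply: scale_set_proper.
- exact: scale_set_proper.
Qed.

(** Only the distinctness of the classes needs an argument: if L' = k L lies between pi L and L,
    then v(k) is 0 or 1, and L' equals one of the two ends, against strictness. *)
Lemma adjacent_of_rep C C' L L' : val C L -> val C' L' ->
  scale_set pi L `<` L' -> L' `<` L -> adjacent pi C C'.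
Proof.
move=> CL C'L' s1 s2; rewrite /adjacent; apply/andP; split; last first.
  by apply/asboolP; exists L, L'.
apply/eqP => CC'; subst C'; have [k k0 E] := val_scale CL C'L'.
have lL := val_lattice CL.
have [B [_ [_ [_ [uB _ _ LB _]]]]] := cartan_decomposition pi lL lL.
move: s1 s2; rewrite E LB !scale_box ?unif_neq0 // lval_unif => -[s1 n1] [s2 n2].
have [h1 _ _] := box_subE pi uB s1; have [h2 _ _] := box_subE pi uB s2.
have [vk|vk] : v k = 0 \/ v k = 1 by lia.
  by apply: n2; rewrite vk.
by apply: n1; rewrite vk.
Qed.

Variables (v0 : vertex v) (L0 : set 'rV[F]_3).
Hypothesis v0L0 : val v0 L0.

(* [C] has elementary divisors (1, pi^i, pi^r) relative to [L0], the rows of [B]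
   being an adapted basis of [L0]. *)
Definition standard (i r : nat) (B : 'M[F]_3) C :=
  [/\ B \in unitmx, L0 = box v 0 0 0 B, (i <= r)%N & val C (box v 0 i r B)].

Lemma base_scale (n : int) B : L0 = box v 0 0 0 B ->
  scale_set ((pi : F) ^ n) L0 = box v n n n B.
Proof. by move=> ->; rewrite scale_box ?unifZ_neq0 // lval_unifZ addr0. Qed.

(** All representatives are pi^e times the standard one. Its smallest exponent is controlled by
    inclusion in [L0] and its largest by the multiples of [L0] that it contains. *)
Lemma standard_rep i r B C L : standard i r B C -> val C L ->
  exists e : int, [/\ L = box v e (e + i) (e + r) B, L `<=` L0 -> 0 <= e &
    forall n : int, scale_set ((pi : F) ^ n) L0 `<=` L -> e + r <= n].
Proof.
move=> [uB L0B ir CB] /(val_scale CB)[k k0 ->]; exists (v k).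
rewrite scale_box // addr0; split=> // [|n].
  by rewrite L0B => /(box_subE pi uB)[].
by rewrite (base_scale _ L0B) => /(box_subE pi uB)[].
Qed.

Lemma standard_sub i r B C : standard i r B C ->
  box v 0 i r B `<=` L0 /\ scale_set ((pi : F) ^ (r : int)) L0 `<=` box v 0 i r B.
Proof.
move=> [uB L0B ir CB]; rewrite (base_scale _ L0B) {1}L0B.
by split; apply: box_sub; lia.
Qed.

(** Both lattices lie between pi^r [L0] and [L0]; these bounds give 0 <= e and e + r <= r for the
    scaling exponent e between them, so e = 0. *)
Lemma standard_box_eq i r B i' B' C : standard i r B C -> standard i' r B' C ->
  box v 0 i r B = box v 0 i' r B'.
Proof.
move=> h h'; have [_ _ _ CB'] := h'; have [s1 s2] := standard_sub h'.
have [e [E /(_ s1) e0 /(_ _ s2) er]] := standard_rep h CB'.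
by rewrite E; have -> : e = 0; [lia | rewrite !add0r].
Qed.

(** The determinants of the two adapted bases have equal valuation, as both bases span [L0];
    comparing those of the equal standard lattices leaves i = i'. *)
Lemma standard_inj i r B i' B' C : standard i r B C -> standard i' r B' C -> i = i'.
Proof.
move=> h h'; have := standard_box_eq h h'.
have [uB L0B _ _] := h; have [uB' L0B' _ _] := h'.
move=> /(box_eq_det pi uB uB').
have := box_eq_det pi uB uB' (etrans (esym L0B) L0B'); lia.
Qed.

(** Each step replaces a representative L by a sublattice containing pi L, so the lower bound loses
    one factor pi per edge. *)
Lemma path_bound p : path (adjacent pi) v0 p ->
  exists2 L, val (last v0 p) L &
    scale_set ((pi : F) ^ (size p : int)) L0 `<=` L /\ L `<=` L0.
Proof.
elim/last_ind: p => [_|p C IH].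
  exists L0; [exact: v0L0 | rewrite expr0z scale_set1].
  by split; apply: subset_refl.
rewrite rcons_path last_rcons size_rcons => /andP[/IH[L vL [s1 s2]] adj].
have [L' [vL' [t1 _] [t2 _]]] := adjacent_rep adj vL.
exists L' => //; split; last exact: subset_trans s2.
apply: subset_trans t1.
by rewrite [_ ^ _]exprS -scale_setM; apply: scale_setS.
Qed.

Lemma standard_path i r B C : standard i r B C ->
  exists p, [/\ path (adjacent pi) v0 p, last v0 p = C & size p = r].
Proof.
elim: r i C => [|r IH] i C [uB L0B ir CB].
  exists [::]; split=> //=; apply: val_inj_lattice v0L0 _.
  by rewrite L0B; move: CB; have -> : i = 0%N by lia.
(* The predecessor lowers the largest exponent from [r.+1] to [r], and the middle one too when it
   equals [r.+1]. *)
have [C' C'B] := exists_vertex (box_is_lattice pi 0 (minn i r) r uB).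
have [|p [pp lp sp]] := IH (minn i r) C'; first by split=> //; lia.
exists (rcons p C); rewrite rcons_path last_rcons size_rcons pp lp sp; split=> //=.
apply: adjacent_of_rep C'B CB _ _; rewrite ?scale_box ?unif_neq0 // ?lval_unif; split.
- by apply: box_sub; lia.
- by move/(box_subE pi uB) => -[]; lia.
- by apply: box_sub; lia.
- by move/(box_subE pi uB) => -[]; lia.
Qed.

(** A path of length n gives a representative between pi^n [L0] and [L0], whence 0 <= e and e + r <=
    n, so r <= n. *)
Lemma standard_distance i r B C : standard i r B C ->
  is_graph_distance (adjacent pi) v0 C r.
Proof.
move=> h; split; first exact: standard_path h.
move=> p /path_bound[L vL [s1 s2]] lp; rewrite lp in vL.
have [e [_ /(_ s2) e0 /(_ _ s1)]] := standard_rep h vL; move: (size p) => n; lia.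
Qed.

Lemma exists_standard C : exists i r B, standard i r B C.
Proof.
have /set_mem [L lL CL] := valP C.
have vL : val C L by rewrite -CL; exists 1; [exact: oner_neq0|exact: scale_set1].
have [B [a [b [c [uB ab bc L0B LB]]]]] := cartan_decomposition pi (val_lattice v0L0) lL.
(* Scaling by pi^(-a) makes the smallest exponent 0; the absolute values only turn nonnegative
   integers into naturals. *)
exists `|b - a|%N, `|c - a|%N, B; split=> //; first lia.
have := vertex_scale (unifZ_neq0 pi (- a)) vL.
rewrite LB scale_box ?unifZ_neq0 // lval_unifZ addNr.
by congr (val C (box v 0 _ _ B)); lia.
Qed.

Lemma sphere_standard r C :
  sphere (adjacent pi) v0 r C <-> exists i B, standard i r B C.
Proof.
split=> [[[p [pp lp sp]] rmin]|[i [B h]]]; last exact: standard_distance h.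
have [i [r' [B h]]] := exists_standard C.
have [[p' [pp' lp' sp']] rmin'] := standard_distance h.
have := rmin _ pp' lp'; have := rmin' _ pp lp; rewrite sp sp' => h1 h2.
have rr' : r = r' by apply/eqP; rewrite eqn_leq h1 h2.
by exists i, B; rewrite rr'.
Qed.

End Vertices.

(** * Edges inside a sphere *)

Section Neighbors.
Variables (F : fieldType) (v : local_valuation F) (pi : uniformizer v).
Implicit Types (B : 'M[F]_3) (L N : set 'rV[F]_3).

(* In L / pi L the sublattice is a plane containing the line of pi^r L0 and not
   contained in the image of pi L0. *)
Lemma index_q_sublattice (i r : nat) B L' w0 w1 w2 :
  B \in unitmx -> is_lattice v L' -> (i <= r)%N ->
  scale_set pi (box v 0 i r B) `<=` L' -> L' `<` box v 0 i r B ->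
  box v r r r B `<=` L' -> L' (pt B w0 w1 w2) -> ~~ val_ge v 1 w0 ->
  (i < r)%N /\ exists2 s, val_ge v i s & L' = box v 0 i.+1 r (shear01 s B).
Proof.
move=> uB lL' ir piL [L'L nLL'] rL' L'w.
have [cD cB] := lattice_closed lL'.
have cZ k w : val_ge v 0 k -> L' w -> L' (k *: w) by apply: lattice_integral_scale.
have inL x y z : L' (pt B x y z) -> [/\ val_ge v 0 x, val_ge v i y & val_ge v r z].
  by move/L'L/(box_pt v _ _ _ _ _ _ uB).
have [h0 h1 h2] := inL _ _ _ L'w.
move=> /val_geNge[w00 vw0]; have {}vw0 : v w0 = 0.
  by move: h0; rewrite val_geE // => h0; lia.
have L'y y : val_ge v i.+1 y -> L' (pt B 0 y 0).
  move=> hy; apply: piL; rewrite scale_box ?unif_neq0 // lval_unif.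
  by exists 0, y, 0; rewrite !val_ge0; split=> //; apply: val_ge_le hy; lia.
have L'z z : val_ge v r z -> L' (pt B 0 0 z).
  by move=> hz; apply: rL'; exists 0, 0, z; rewrite !val_ge0.
have div0 x : val_ge v 0 x -> val_ge v 0 (x / w0).
  by move=> hx; apply: val_ge_div hx w00 _; rewrite vw0.
(* The vector w generates L' modulo vectors with first coordinate 0; subtracting a multiple of it
   clears that coordinate, and s is its slope. *)
pose s := w1 / w0.
have hs : val_ge v i s by apply: val_ge_div h1 w00 _; lia.
have reduce x y z :
    pt B x y z - (x / w0) *: pt B w0 w1 w2 = pt B 0 (y - s * x) (z - x / w0 * w2).
  by rewrite scale_pt sub_pt divfK // subrr /s; congr pt; ring.
(* A vector of L' with first coordinate 0 and second coordinate of valuation exactly i would,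
   together with w, generate the whole box, against strictness. *)
have hy y z : L' (pt B 0 y z) -> val_ge v i.+1 y.
  move=> L'yz; have [_ hy hz] := inL _ _ _ L'yz; apply/negPn/negP.
  move=> /val_geNge[y0 vy]; apply: nLL' => _ [x1 [y1 [z1 [hx1 hy1 hz1 ->]]]].
  have L'y0 : L' (pt B 0 y 0).
    have -> : pt B 0 y 0 = pt B 0 y z - pt B 0 0 z by rewrite sub_pt !subr0 subrr.
    by apply: cB => //; apply: L'z.
  rewrite -(subrK ((x1 / w0) *: pt B w0 w1 w2) (pt B x1 y1 z1)).
  apply: (cD); last by apply: cZ => //; apply: div0.
  rewrite reduce; set y2 := y1 - _; set z2 := z1 - _.
  have hy2 : val_ge v i y2.
    by apply: val_geB => //; rewrite -[X in val_ge v X]addr0; apply: val_geM.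
  have hz2 : val_ge v r z2 by apply: val_geB => //; apply: val_geM0 => //; apply: div0.
  have -> : pt B 0 y2 z2 = (y2 / y) *: pt B 0 y 0 + pt B 0 0 z2.
    by rewrite scale_pt add_pt !mulr0 divfK // !addr0 add0r.
  apply: (cD); last exact: L'z.
  by apply: cZ => //; apply: val_ge_div hy2 y0 _; lia.
split.
  (* If i = r, then pi^r e2 lies in pi^r L0, hence in L', which [hy] forbids. *)
  rewrite ltn_neqAle ir andbT; apply/eqP => ir'.
  have : L' (pt B 0 ((pi : F) ^ (r : int)) 0).
    apply: rL'; exists 0, ((pi : F) ^ (r : int)), 0; rewrite !val_ge0.
    by split=> //; rewrite val_geE ?unifZ_neq0 // lval_unifZ.
  by move/hy; rewrite val_geE ?unifZ_neq0 // lval_unifZ ir'; lia.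
exists s => //; apply/seteqP; split=> w.
  move=> L'w'; have [x [y [z wE]]] := ptP w uB; rewrite wE in L'w' *.
  have [hx hy' hz] := inL _ _ _ L'w'.
  exists x, (y - s * x), z; rewrite pt_shear01 subrK; split=> //.
  apply: (hy _ (z - x / w0 * w2)); rewrite -reduce; apply: cB => //.
  by apply: cZ => //; apply: div0.
move=> [x [y [z [hx hy' hz ->]]]]; rewrite pt_shear01.
rewrite -(subrK ((x / w0) *: pt B w0 w1 w2) (pt B x _ z)).
apply: (cD); last by apply: cZ => //; apply: div0.
rewrite reduce addrK; set z2 := z - _.
have -> : pt B 0 y z2 = pt B 0 y 0 + pt B 0 0 z2 by rewrite add_pt !addr0 add0r.
apply: (cD); first exact: L'y.
by apply: L'z; apply: val_geB => //; apply: val_geM0 => //; apply: div0.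
Qed.

(** Let L be the smaller box. Inclusion in L0 excludes pi^-1 e1 from N, and since i + 1 < r the
    failure of pi^(r-1) L0 to lie in N excludes pi^(r-1) e3. So N / L is a line in L / pi L up to
    scaling, spanned by a vector whose second coordinate has valuation exactly i. *)
Lemma index_q_superlattice (i r : nat) B N :
  B \in unitmx -> is_lattice v N -> (i.+1 < r)%N ->
  box v 0 i.+1 r B `<` N -> scale_set pi N `<=` box v 0 i.+1 r B ->
  N `<=` box v 0 0 0 B -> ~ box v r.-1 r.-1 r.-1 B `<=` N ->
  exists2 s, val_ge v (r - i.+1)%N s & N = box v 0 i r (shear12 s B).
Proof.
move=> uB lN ir [LN nNL] piN NL0 nrN.
have [cD cB] := lattice_closed lN.
have cZ k w : val_ge v 0 k -> N w -> N (k *: w) by apply: lattice_integral_scale.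
have NL x y z : val_ge v 0 x -> val_ge v i.+1 y -> val_ge v r z -> N (pt B x y z).
  by move=> hx hy hz; apply: LN; exists x, y, z.
have inN x y z : N (pt B x y z) ->
    [/\ val_ge v 0 x, val_ge v i y & val_ge v r.-1 z].
  move=> Nw; have [hx _ _] := (box_pt v _ _ _ _ _ _ uB).1 (NL0 _ Nw).
  have : box v 0 i.+1 r B ((pi : F) *: pt B x y z) by apply: piN; exists (pt B x y z).
  rewrite scale_pt => /(box_pt v _ _ _ _ _ _ uB)[_].
  rewrite !val_geMl ?unif_neq0 // !lval_unif => hy hz.
  by split=> //; [apply: val_ge_le hy|apply: val_ge_le hz]; lia.
(* Otherwise z has valuation exactly r - 1; then pi^(r-1) e3 is in N, and with L this puts all of
   pi^(r-1) L0 in N. *)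
have hz x y z : N (pt B x y z) -> val_ge v i.+1 y -> val_ge v r z.
  move=> Nw hy; have [hx _ hz] := inN _ _ _ Nw; apply/negPn/negP => /val_geNge[z0 vz].
  apply: nrN => _ [x1 [y1 [z1 [hx1 hy1 hz1 ->]]]].
  have Nz : N (pt B 0 0 z).
    have -> : pt B 0 0 z = pt B x y z - pt B x y 0 by rewrite sub_pt !subrr subr0.
    by apply: cB => //; apply: NL => //; apply: val_ge0.
  have -> : pt B x1 y1 z1 = pt B x1 y1 0 + (z1 / z) *: pt B 0 0 z.
    by rewrite scale_pt add_pt !mulr0 divfK // !addr0 add0r.
  apply: (cD); last by apply: cZ => //; apply: val_ge_div hz1 z0 _; lia.
  apply: (NL); last exact: val_ge0.
    by apply: val_ge_le hx1; lia.
  by apply: val_ge_le hy1; lia.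
(* Without such a vector, [hz] would give the inclusion of N in the smaller box. *)
have [w0 [w1 [w2 [Nw nw1]]]] : exists w0 w1 w2,
    N (pt B w0 w1 w2) /\ ~~ val_ge v i.+1 w1.
  apply: contrapT => h; apply: nNL => w Nw.
  have [x [y [z wE]]] := ptP w uB; rewrite wE in Nw *.
  have hy : val_ge v i.+1 y by apply/negPn/negP => ny; apply: h; exists x, y, z.
  by have [hx _ _] := inN _ _ _ Nw; exists x, y, z; split=> //; apply: hz Nw hy.
have [hw0 hw1 hw2] := inN _ _ _ Nw.
have [w10 vw1] := val_geNge nw1.
have {}vw1 : v w1 = i by move: hw1; rewrite val_geE // => hw1; lia.
pose s := w2 / w1.
have div1 y : val_ge v i y -> val_ge v 0 (y / w1).
  by move=> hy; apply: val_ge_div hy w10 _; lia.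
have reduce x y z :
    pt B x y z - (y / w1) *: pt B w0 w1 w2 = pt B (x - y / w1 * w0) 0 (z - s * y).
  by rewrite scale_pt sub_pt divfK // subrr /s; congr pt; ring.
exists s; first by apply: val_ge_div hw2 w10 _; lia.
apply/seteqP; split=> w.
  move=> Nw'; have [x [y [z wE]]] := ptP w uB; rewrite wE in Nw' *.
  have [hx hy _] := inN _ _ _ Nw'.
  exists x, y, (z - s * y); rewrite pt_shear12 subrK; split=> //.
  apply: (hz (x - y / w1 * w0) 0); last exact: val_ge0.
  by rewrite -reduce; apply: cB => //; apply: cZ => //; apply: div1.
move=> [x [y [z [hx hy hz' ->]]]]; rewrite pt_shear12.
rewrite -(subrK ((y / w1) *: pt B w0 w1 w2) (pt B x y _)).
apply: (cD); last by apply: cZ => //; apply: div1.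
rewrite reduce addrK; apply: NL => //; last exact: val_ge0.
by apply: val_geB => //; apply: val_geM0 => //; apply: div1.
Qed.

End Neighbors.

(** * Direction of an edge inside a sphere *)

Section Spheres.
Variables (F : fieldType) (v : local_valuation F) (pi : uniformizer v).
Variables (L0 : set 'rV[F]_3) (r : nat).
Implicit Types (B : 'M[F]_3) (C : vertex v) (L : set 'rV[F]_3).

Local Notation standard i B C := (standard L0 i r B C).

(** The representative of C' below the standard lattice of C is pi^e times its own standard lattice.
    The bounds by multiples of [L0] leave e = 0 or e = 1, and e = 1 exchanges the roles of the two
    vertices. *)
Lemma edge_direction i B C i' B' C' : standard i B C -> standard i' B' C' ->
  adjacent pi C C' ->
  (scale_set pi (box v 0 i r B) `<` box v 0 i' r B' /\
   box v 0 i' r B' `<` box v 0 i r B) \/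
  (scale_set pi (box v 0 i' r B') `<` box v 0 i r B /\
   box v 0 i r B `<` box v 0 i' r B').
Proof.
move=> h h' adj; have [uB L0B ir CB] := h.
have [L' [C'L' s1 s2]] := adjacent_rep adj CB.
have [sL rL] := standard_sub pi h.
have [e [L'E e0 er]] := standard_rep pi h' C'L'.
have {}e0 := e0 (subset_trans (properW s2) sL).
have e1 : e + r <= r.+1.
  apply: er; apply: subset_trans (properW s1).
  by rewrite [_ ^ _]exprS -scale_setM; apply: scale_setS.
have [E|E] : e = 0 \/ e = 1 by lia.
  by left; move: s1 s2; rewrite L'E E !add0r.
right; have L'E' : L' = scale_set pi (box v 0 i' r B').
  by rewrite scale_box ?unif_neq0 // lval_unif L'E E addr0.
rewrite -L'E'; split=> //.
have pi0 : (pi : F)^-1 != 0 by rewrite invr_eq0 unif_neq0.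
move: s1; rewrite L'E' => /(scale_set_proper pi0).
by rewrite !scale_setM mulVf ?unif_neq0 // !scale_set1.
Qed.

(** It suffices to find one basis of [L0] adapted to both lattices, the smaller having exponents 0,
    i + 1, r. A vector of that lattice outside pi [L0] supplies it. *)
Lemma common_frame i B C i' B' C' : (0 < r)%N -> standard i B C -> standard i' B' C' ->
  scale_set pi (box v 0 i r B) `<` box v 0 i' r B' ->
  box v 0 i' r B' `<` box v 0 i r B -> i' = i.+1.
Proof.
move=> r_gt0 h h' s1 s2; have [uB L0B ir CB] := h.
have [uB' L0B' ir' CB'] := h'; set L' := box v 0 i' r B' in s1 s2 CB'.
suff [i_lt_r [B'' [uB'' L0B'' L'E]]] : (i < r)%N /\ exists B'',
    [/\ B'' \in unitmx, L0 = box v 0 0 0 B'' & L' = box v 0 i.+1 r B''].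
  have h'' : standard i.+1 B'' C' by split=> //; rewrite -L'E.
  exact: (standard_inj pi h' h'').
have lL' : is_lattice v L' by apply: box_is_lattice.
have rL' : box v r r r B `<=` L'.
  by rewrite -(base_scale pi _ L0B); case: (standard_sub pi h').
(* The smallest exponent of L' in its own adapted basis is 0, so L' is not contained in pi [L0]. *)
have [w [L'w nw]] : exists w, L' w /\ ~ box v 1 1 1 B w.
  apply: contrapT => hn; have : L' `<=` box v 1 1 1 B.
    by move=> w L'w; apply: contrapT => nw; apply: hn; exists w.
  rewrite -(base_scale pi _ L0B) (base_scale pi _ L0B').
  by move=> /(box_subE pi uB')[].
have [w0 [w1 [w2 wE]]] := ptP w uB; rewrite wE in L'w nw.
have [h0 h1 h2] := (box_pt v _ _ _ _ _ _ uB).1 (properW s2 L'w).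
(* As r > 0, the third coordinate of w is divisible by pi. If the first is too, the second is a
   unit, which forces i = 0, and e1 and e2 may be swapped. *)
case: (boolP (val_ge v 1 w0)) => n0.
  have n1 : ~~ val_ge v 1 w1.
    apply/negP => n1; apply: nw; exists w0, w1, w2; split=> //.
    by apply: val_ge_le h2; lia.
  have i0 : i = 0%N.
    by move: n1; case: (i) h1 => // j h1 /negP[]; apply: val_ge_le h1; lia.
  subst i; have [] := @index_q_sublattice _ _ pi 0 r (swap01 B) L' w1 w0 w2.
  all: rewrite ?box_swap01 ?swap01_unit ?pt_swap01 //.
  - exact: properW.
  - move=> i_lt_r [s hs ->]; split=> //; exists (shear01 s (swap01 B)).
    by rewrite shear01_unit ?swap01_unit // box_shear01 ?subr0 // box_swap01.
have [] := @index_q_sublattice _ _ pi i r B L' w0 w1 w2 => //.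
  exact: properW.
move=> i_lt_r [s hs ->]; split=> //; exists (shear01 s B).
rewrite shear01_unit // box_shear01 ?subr0 //.
by apply: val_ge_le hs; lia.
Qed.

(** * Neighbours of a vertex of intermediate height *)

Section Height.
Variables (i : nat) (B : 'M[F]_3) (C : vertex v).
Hypotheses (hC : standard i.+1 B C) (i_lt_r : (i.+1 < r)%N).

Let r_gt0 : (0 < r)%N. Proof. exact: leq_ltn_trans i_lt_r. Qed.

(** The height of [C] is written [i.+1], so its neighbours lie at heights [i.+2] and [i]. Each shear
    is fine enough to fix the standard lattice of [C] and [L0], but not the neighbouring lattice. *)
Definition up_lattice (t : F) :=
  box v 0 i.+2 r (shear01 (t * (pi : F) ^ (i.+1 : int)) B).
Definition down_lattice (t : F) :=
  box v 0 i r (shear12 (t * (pi : F) ^ ((r - i.+1)%N : int)) B).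

Lemma val_ge_mulunif t (n : int) : val_ge v 0 t -> val_ge v n (t * (pi : F) ^ n).
Proof.
by move=> ht; apply: val_geM0 => //; rewrite val_geE ?unifZ_neq0 // lval_unifZ.
Qed.

Lemma up_shear t : val_ge v 0 t ->
  box v 0 i.+1 r B = box v 0 i.+1 r (shear01 (t * (pi : F) ^ (i.+1 : int)) B).
Proof. by move=> ht; rewrite box_shear01 // subr0; apply: val_ge_mulunif. Qed.

Lemma down_shear t : val_ge v 0 t ->
  box v 0 i.+1 r B = box v 0 i.+1 r (shear12 (t * (pi : F) ^ ((r - i.+1)%N : int)) B).
Proof.
move=> ht; rewrite box_shear12 //.
by apply: val_ge_le (val_ge_mulunif _ ht); lia.
Qed.

Lemma standard_up t C' : val_ge v 0 t -> val C' (up_lattice t) ->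
  standard i.+2 (shear01 (t * (pi : F) ^ (i.+1 : int)) B) C'.
Proof.
move=> ht hC'; have [uB L0B _ _] := hC; split=> //; first exact: shear01_unit.
by rewrite box_shear01 // subrr; apply: val_ge_le (val_ge_mulunif _ ht).
Qed.

Lemma standard_down t C' : val_ge v 0 t -> val C' (down_lattice t) ->
  standard i (shear12 (t * (pi : F) ^ ((r - i.+1)%N : int)) B) C'.
Proof.
move=> ht hC'; have [uB L0B _ _] := hC; split=> //; first exact: shear12_unit.
  by rewrite box_shear12 // subrr; apply: val_ge_le (val_ge_mulunif _ ht).
by lia.
Qed.

Lemma adjacent_up t C' : val_ge v 0 t -> val C' (up_lattice t) -> adjacent pi C C'.
Proof.
move=> ht hC'; have [uB L0B _ CB] := hC.
have uB' := shear01_unit (t * (pi : F) ^ (i.+1 : int)) uB.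
apply: adjacent_of_rep CB hC' _ _.
all: rewrite (up_shear ht) /up_lattice ?scale_box ?unif_neq0 // ?lval_unif.
all: split; [apply: box_sub; lia|move/(box_subE pi uB') => -[]; lia].
Qed.

Lemma adjacent_down t C' : val_ge v 0 t -> val C' (down_lattice t) -> adjacent pi C C'.
Proof.
move=> ht hC'; have [uB L0B _ CB] := hC; rewrite adjacent_sym.
have uB' := shear12_unit (t * (pi : F) ^ ((r - i.+1)%N : int)) uB.
apply: adjacent_of_rep hC' CB _ _.
all: rewrite (down_shear ht) /down_lattice ?scale_box ?unif_neq0 // ?lval_unif.
all: split; [apply: box_sub; lia|move/(box_subE pi uB') => -[]; lia].
Qed.

Lemma div_unifP s (n : int) : val_ge v n s ->
  val_ge v 0 (s / (pi : F) ^ n) /\ s = s / (pi : F) ^ n * (pi : F) ^ n.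
Proof.
move=> hs; rewrite divfK ?unifZ_neq0 //; split=> //.
by apply: val_ge_div hs _ _; rewrite ?unifZ_neq0 // lval_unifZ; lia.
Qed.

Lemma neighbor_up B' C' : standard i.+2 B' C' -> adjacent pi C C' ->
  exists2 t, val_ge v 0 t & val C' (up_lattice t).
Proof.
move=> h' adj; have [uB L0B _ CB] := hC; have [uB' L0B' _ CB'] := h'.
have [[s1 s2]|[s1 s2]] := edge_direction hC h' adj; last first.
  by have := common_frame r_gt0 h' hC s1 s2; lia.
set L' := box v 0 i.+2 r B' in s1 s2 CB' *.
have lL' : is_lattice v L' by apply: box_is_lattice.
have rL' : box v r r r B `<=` L'.
  by rewrite -(base_scale pi _ L0B); case: (standard_sub pi h').
have [w [L'w nw]] : exists w, L' w /\ ~ box v 1 1 1 B w.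
  apply: contrapT => hn; have : L' `<=` box v 1 1 1 B.
    by move=> w L'w; apply: contrapT => nw; apply: hn; exists w.
  rewrite -(base_scale pi _ L0B) (base_scale pi _ L0B').
  by move=> /(box_subE pi uB')[].
have [w0 [w1 [w2 wE]]] := ptP w uB; rewrite wE in L'w nw.
have [h0 h1 h2] := (box_pt v _ _ _ _ _ _ uB).1 (properW s2 L'w).
have n0 : ~~ val_ge v 1 w0.
  apply/negP => n0; apply: nw; exists w0, w1, w2; split=> //.
    by apply: val_ge_le h1; lia.
  by apply: val_ge_le h2; lia.
have [] := @index_q_sublattice _ _ pi i.+1 r B L' w0 w1 w2 => //.
- by lia.
- exact: properW.
move=> _ [s /div_unifP[hs sE] L'E]; exists (s / (pi : F) ^ (i.+1 : int)) => //.
by rewrite /up_lattice -sE -L'E.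
Qed.

Lemma neighbor_down B' C' : standard i B' C' -> adjacent pi C C' ->
  exists2 t, val_ge v 0 t & val C' (down_lattice t).
Proof.
move=> h' adj; have [uB L0B _ CB] := hC; have [uB' L0B' _ CB'] := h'.
have [[s1 s2]|[s1 s2]] := edge_direction hC h' adj.
  by have := common_frame r_gt0 hC h' s1 s2; lia.
set N := box v 0 i r B' in s1 s2 CB' *.
have lN : is_lattice v N by apply: box_is_lattice.
have [] := @index_q_superlattice _ _ pi i r B N => //.
- exact: properW.
- by rewrite -L0B; case: (standard_sub pi h').
- have [e [E _ er]] := standard_rep pi h' CB'.
  rewrite -(base_scale pi _ L0B) (base_scale pi _ L0B') => /(box_subE pi uB')[]; lia.
move=> s /div_unifP[hs sE] NE.
exists (s / (pi : F) ^ ((r - i.+1)%N : int)) => //.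
by rewrite /down_lattice -sE -NE.
Qed.

(** The shear parameter matters modulo pi^(i+2) and t enters multiplied by pi^(i+1), so exactly the
    class of t in O / pi remains. *)
Lemma up_lattice_eq t t' : up_lattice t = up_lattice t' <-> val_ge v 1 (t - t').
Proof.
have [uB _ _ _] := hC; rewrite (box_shear01_eq pi) // -mulrBl mulrC.
rewrite val_geMl ?unifZ_neq0 // lval_unifZ.
by rewrite (_ : _ - _ = 1) //; lia.
Qed.

Lemma down_lattice_eq t t' : down_lattice t = down_lattice t' <-> val_ge v 1 (t - t').
Proof.
have [uB _ _ _] := hC; rewrite (box_shear12_eq pi) // -mulrBl mulrC.
rewrite val_geMl ?unifZ_neq0 // lval_unifZ.
by rewrite (_ : _ - _ = 1) //; lia.
Qed.

(** The graph of a bijection between upper and lower neighbours, given by a common parameter t; as a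
    relation it needs no choice of representatives of O / pi. *)
Definition up_down_pair (C' C'' : vertex v) :=
  exists t, [/\ val_ge v 0 t, val C' (up_lattice t) & val C'' (down_lattice t)].

Lemma up_down_pair_injl C1 C2 C' : up_down_pair C1 C' -> up_down_pair C2 C' -> C1 = C2.
Proof.
move=> [t [ht u d]] [t' [ht' u' d']]; apply: val_inj_lattice u _.
suff -> : up_lattice t = up_lattice t' by [].
apply/up_lattice_eq/down_lattice_eq.
exact: (standard_box_eq pi (standard_down ht d) (standard_down ht' d')).
Qed.

Lemma up_down_pair_injr C' C1 C2 : up_down_pair C' C1 -> up_down_pair C' C2 -> C1 = C2.
Proof.
move=> [t [ht u d]] [t' [ht' u' d']]; apply: val_inj_lattice d _.
suff -> : down_lattice t = down_lattice t' by [].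
apply/down_lattice_eq/up_lattice_eq.
exact: (standard_box_eq pi (standard_up ht u) (standard_up ht' u')).
Qed.

End Height.

End Spheres.

Lemma leq_card_rel (T : finType) (A A' : {set T}) (e : T -> T -> Prop) :
  (forall x, x \in A -> exists2 y, y \in A' & e x y) ->
  (forall x x' y, e x y -> e x' y -> x = x') -> (#|A| <= #|A'|)%N.
Proof.
move=> ex inj; have /choice[f fP] : forall x, exists y, x \in A -> y \in A' /\ e x y.
  move=> x; case: (boolP (x \in A)) => [/ex[y yA exy]|_]; first by exists y.
  by exists x.
rewrite -(card_in_imset (f := f)); last first.
  move=> x x' /fP[_ ex1] /fP[_ ex2] E; rewrite E in ex1; exact: inj ex1 ex2.
by apply/subset_leq_card/fintype.subsetP => _ /imsetP[x /fP[fA _] ->].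
Qed.

(** * The sphere as a balanced layered graph *)

Section SphereGraph.
Variables (F : fieldType) (v : local_valuation F) (pi : uniformizer v).
Variables (v0 : vertex v) (L0 : set 'rV[F]_3).
Hypothesis v0L0 : val v0 L0.
Variable r : nat.
Hypothesis r_gt0 : (0 < r)%N.

Let G := sphere_graph pi v0 r.

Lemma sphere_graph_standard (x : G) : exists i B, standard L0 i r B (val x).
Proof.
apply/(sphere_standard pi v0L0); have := valP x.
rewrite in_fset_set; last exact: finite_sphere.
by move/set_mem.
Qed.

Lemma standard_sphere_graph i B C : standard L0 i r B C -> exists x : G, val x = C.
Proof.
move=> h; have Cs : C \in fset_set (sphere (adjacent pi) v0 r).
  rewrite in_fset_set; last exact: finite_sphere.
  by apply/mem_set/(sphere_standard pi v0L0); exists i, B.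
by exists (Sub C Cs).
Qed.

(** The height is chosen vertex by vertex; [standard_inj] makes it independent of the adapted
    basis. *)
Lemma exists_height : exists h : G -> nat, forall x, exists B, standard L0 (h x) r B (val x).
Proof. by have [h hP] := choice sphere_graph_standard; exists h. Qed.

Lemma sphere_graph_conductance (R : realType) k : ((2 * k).+1 <= r)%N ->
  (conductance R G <= ((2 * k).+1%:R^-1 : R)%:E)%E.
Proof.
move=> kr; have [h hP] := exists_height.
have hE x i B : standard L0 i r B (val x) -> h x = i.
  by move=> s; have [B' s'] := hP x; exact: (standard_inj pi s' s).
apply: (@layered_conductance G h r) => //.
- move=> x y adj; have [B hB] := hP x; have [B' hB'] := hP y.
  have [[s1 s2]|[s1 s2]] := edge_direction hB hB' adj.
    by left; apply: common_frame r_gt0 hB hB' s1 s2.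
  by right; rewrite (common_frame r_gt0 hB' hB s1 s2).
- by move=> x; have [B []] := hP x.
- move=> x /andP[h0 hr]; have [B hB] := hP x.
  move: hB; case E : (h x) h0 hr => [//|i] _ hr hB.
  have upP y : (y \in [set y | fedge x y && (h y == i.+2)]%SET) <->
      exists2 t, val_ge v 0 t & val (val y) (up_lattice pi r i B t).
    rewrite inE; split=> [/andP[adj /eqP hy]|[t ht ut]].
      by have [B' hB'] := hP y; rewrite hy in hB'; apply: (neighbor_up hB hr hB').
    rewrite (hE _ _ _ (standard_up hB hr ht ut)) eqxx andbT.
    exact: (adjacent_up hB hr ht ut).
  have downP y : (y \in [set y | fedge x y && ((h y).+1 == i.+1)]%SET) <->
      exists2 t, val_ge v 0 t & val (val y) (down_lattice pi r i B t).
    rewrite inE; split=> [/andP[adj /eqP[hy]]|[t ht ut]].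
      by have [B' hB'] := hP y; rewrite hy in hB'; apply: (neighbor_down hB hr hB').
    rewrite (hE _ _ _ (standard_down hB hr ht ut)) eqxx andbT.
    exact: (adjacent_down hB hr ht ut).
  have uB : B \in unitmx by case: hB.
  (* Every upper neighbour is paired with a lower one and conversely; injectivity on each side gives
     the two inequalities. *)
  apply/eqP; rewrite eqn_leq; apply/andP; split.
    apply: (leq_card_rel (e := fun y z => up_down_pair pi r i B (val y) (val z))).
      move=> y /upP[t ht ut].
      have [C CP] := exists_vertex (box_is_lattice pi 0 i r
        (shear12_unit (t * (pi : F) ^ ((r - i.+1)%N : int)) uB)).
      have [z zC] := standard_sphere_graph (standard_down hB hr ht CP).
      exists z; last by exists t; rewrite zC.
      by apply/downP; exists t; rewrite ?zC.
    move=> y y' z p p'; apply: val_inj; exact: (up_down_pair_injl hB hr p p').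
  apply: (leq_card_rel (e := fun z y => up_down_pair pi r i B (val y) (val z))).
    move=> z /downP[t ht dt].
    have [C CP] := exists_vertex (box_is_lattice pi 0 i.+2 r
      (shear01_unit (t * (pi : F) ^ (i.+1 : int)) uB)).
    have [y yC] := standard_sphere_graph (standard_up hB hr ht CP).
    exists y; last by exists t; rewrite yC.
    by apply/upP; exists t; rewrite ?yC.
  move=> z z' y p p'; apply: val_inj; exact: (up_down_pair_injr hB hr p p').
(* A vertex of height 0 is <e1, e2, pi^r e3>; comparing [L0] with itself merely provides a basis of
   it. *)
- have [B [a [b [c [uB _ _ L0B _]]]]] :=
    cartan_decomposition pi (val_lattice v0L0) (val_lattice v0L0).
  have [C CB] := exists_vertex (box_is_lattice pi 0 0 r uB).
  have hC : standard L0 0 r B C by [].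
  have [x xC] := standard_sphere_graph hC.
  by exists x; apply: (hE _ _ B); rewrite xC.
Qed.

End SphereGraph.

Theorem proposition4p1 (R : realType) (F : fieldType) (v : local_valuation F)
    (pi : uniformizer v) (v0 : vertex v) :
  ~ expander_family R (fun n : nat => sphere_graph pi v0 n.+1).
Proof.
move=> [c c0 cG].
have [L0 v0L0] : exists L0, val v0 L0.
  have /set_mem [L lL E] := valP v0; exists L; rewrite -E.
  by exists 1; [exact: oner_neq0|exact: scale_set1].
(* This k exceeds 1 / c. The family starts at radius 1, so its member of index [2 * k] is the sphere
   of radius 2k + 1, of conductance at most 1 / (2k + 1) < c. *)
pose k := Num.bound c^-1.
have := le_trans (cG (2 * k)%N) (sphere_graph_conductance pi v0L0 (ltn0Sn _) R (leqnn _)).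
rewrite lee_fin => h.
have : c^-1 < k%:R by apply: archi_boundP; rewrite invr_ge0 ltW.
rewrite ltNge => /negP; apply.
have : (2 * k).+1%:R <= c^-1 by rewrite -[leLHS]invrK lef_pV2 // posrE ?invr_gt0 ?ltr0n.
by apply: le_trans; rewrite ler_nat; lia.
Qed.
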